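(* Let $\Gamma$ be a finitely generated marked group, let $(X,\mu)$ be a standard probability space, and let $\mathsf a,\mathsf b:\Gamma\curvearrowright (X,\mu)$ be (not necessarily free) probability-measure-preserving actions. The following are equivalent: (1) $\mathsf a$ local-global contains $\mathsf b$ (as labelled Schreier graphs), i.e. $\mathcal L_{r,k}(\mathsf b)\subseteq\mathcal L_{r,k}(\mathsf a)$ for all $r,k\in\mathbb N$; (2) for every $\Sigma_1$-sentence $\phi$ in the language $\mathcal L^+$, $\phi^{M^+(\mathsf a)}\le\phi^{M^+(\mathsf b)}$; (3) $\mathsf a$ weakly contains $\mathsf b$ via a stabilizer-preserving factor map: there are an ultrapower $\mathsf a^{\mathcal U}$ of $\mathsf a$ and a measure-preserving $\Gamma$-equivariant factor map $\pi$ from $\mathsf a^{\mathcal U}$ onto $\mathsf b$ such that, for almost every $x$ and every $\gamma\in\Gamma$, $\gamma\cdot x=x$ if and only if $\gamma\cdot\pi(x)=\pi(x)$.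
   Context: A marked group is a group $\Gamma$ with a specified finite symmetric generating set; $e$ is the identity and $B_r(e)$ is the ball of radius $r$ around $e$ in the Cayley graph. $[k]=\{1,\dots,k\}$. Ultrapowers. For a nonprincipal ultrafilter $\mathcal U$ on $\mathbb N$, $\mathsf a^{\mathcal U}$ is the coordinatewise action of $\Gamma$ on $X_{\mathcal U}=X^{\mathbb N}/\!\sim_{\mathcal U}$ (sequences identified when they agree on a set in $\mathcal U$), with the complete probability measure $\mu_{\mathcal U}$ determined by $\mu_{\mathcal U}(\{[x_i]: \{i:x_i\in A_i\}\in\mathcal U\})=\lim_{\mathcal U}\mu(A_i)$ for measurable $A_i\subseteq X$. Local statistics for general actions. A quotient $r$-ball is an equivalence relation on $B_r(e)$. For $x\in X$, $B_r(x,\mathsf a)$ is the quotient $r$-ball with $\gamma\sim\delta$ iff $\gamma\cdot x=\delta\cdot x$. $\mathbb L(r,k,\Gamma)$ is the finite set of pairs $(Q,h)$ with $Q$ a quotient $r$-ball and $h:B_r(e)/Q\to[k]$. For measurable $f:X\to[k]$, $\mu^r(f)$ is the probability measure on $\mathbb L(r,k,\Gamma)$ with $\mu^r(f)(\{(Q,h)\})=\mu(\{x: B_r(x,\mathsf a)=Q,\ (\forall\gamma\in B_r(e))\ f(\gamma\cdot x)=h([\gamma]_Q)\})$. $\mathcal L_{r,k}(\mathsf a)$ is the closure in total variation of $\{\mu^r(f):f:X\to[k]\text{ measurable}\}$. Model theory. $M^+(\mathsf a)$ is $L^2(X,\mu)$ with its Hilbert space operations, pointwise multiplication and conjugation $*$,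 the automorphisms $(\gamma\cdot f)(x)=f(\gamma^{-1}\cdot x)$ for $\gamma\in\Gamma$, and constants $\mathbf 1$ and, for each $\gamma\in\Gamma$, the characteristic function $\mathbf 1_{\mathrm{fix}(\gamma)}$ of $\{x:\gamma\cdot x=x\}$; since products must be defined, variables range over $L^\infty(X,\mu)$. Terms of $\mathcal L^+$ are built from variables and these constants by sums, pointwise products, $*$, multiplication by scalars in $\mathbb C$, and $\tau\mapsto\gamma\cdot\tau$. Quantifier-free formulas are built from the real and imaginary parts of $\langle\tau_1,\tau_2\rangle=\int\tau_1\overline{\tau_2}\,d\mu$ by applying uniformly continuous functions $c:\mathbb R^n\to\mathbb R$. A $\Sigma_1$-sentence of $\mathcal L^+$ is $\phi=\inf_{x_1,\dots,x_n}\psi(x_1,\dots,x_n)$ with $\psi$ quantifier-free and bounded below; $\phi^{M^+(\mathsf a)}$ is its value with the infimum taken over $M^+(\mathsf a)$. *)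

(* Defs.v *)
From HB Require Import structures.
From mathcomp Require Import all_boot all_order all_algebra.
From mathcomp Require Import generic_quotient.
From mathcomp Require Import complex.
From mathcomp Require Import all_classical all_reals all_analysis.

Set Implicit Arguments.
Unset Strict Implicit.
Unset Printing Implicit Defensive.
Import Order.TTheory GRing.Theory Num.Theory.
Import numFieldNormedType.Exports.

Local Open Scope classical_set_scope.
Local Open Scope ring_scope.

Definition marking (G : groupType) (S : seq G) : Prop :=
  (forall s, s \in S -> (s^-1)%g \in S) /\
  (forall g : G, exists w : seq G,
     {subset w <= S} /\ g = (\big[*%g/1%g]_(s <- w) s)).

(* Since a marking S is symmetric, the words of length at most r in S are the
   r-ball around the identity in both the left and the right Cayley graph. *)
Fixpoint cayley_ball (G : groupType) (S : seq G) (r : nat) : seq G :=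
  if r is r'.+1 then
    cayley_ball S r' ++ [seq (s * g)%g | s <- S, g <- cayley_ball S r']
  else [:: 1%g].

(* A Hausdorff second countable complete pseudometric space is a Polish space
   with a chosen complete metric, and <<s open >> is its Borel sigma-algebra. *)
Definition standard_borel (R : realType) (d : measure_display)
    (X : measurableType d) : Prop :=
  exists (P : completePseudoMetricType R) (phi : X -> P),
    [/\ hausdorff_space P, @second_countable P, bijective phi &
        forall B : set P, measurable (phi @^-1` B) <-> <<s open >> B].

Record pmp_action (R : realType) (G : groupType) (d : measure_display)
    (X : measurableType d) (mu : probability X R) := PmpAction {
  act :> G -> X -> X ;
  act1 : forall x, act 1%g x = x ;
  actM : forall g h x, act (g * h)%g x = act g (act h x) ;
  act_measurable : forall g, measurable_fun setT (act g) ;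
  act_preserving : forall g (A : set X), measurable A ->
    mu (act g @^-1` A) = mu A }.

Section quotient_balls.
Context (G : groupType) (S : seq G) (r : nat).

Definition ballT : finType := seq_sub (cayley_ball S r).

Definition is_qball (Q : {set ballT * ballT}) : bool :=
  `[< equivalence_rel (fun g h => (g, h) \in Q) >].

Definition qball : finType := {Q : {set ballT * ballT} | is_qball Q}.

Definition qclass (Q : qball) (g : ballT) : {set ballT} :=
  [set h | (g, h) \in val Q]%SET.

Definition qquot (Q : qball) : finType :=
  {C : {set ballT} | C \in [set qclass Q g | g : ballT]%SET}.

Definition qproj (Q : qball) (g : ballT) : qquot Q :=
  exist _ (qclass Q g) (imset_f (qclass Q) isT).

Definition labelled_qball (k : nat) : finType :=
  {Q : qball & {ffun qquot Q -> 'I_k}}.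

End quotient_balls.

Section local_statistics.
Context (R : realType) (G : groupType) (S : seq G) (d : measure_display).
Context (X : measurableType d) (mu : probability X R) (a : pmp_action G mu).
Context (r k : nat).
Local Notation B := (ballT S r).

Definition orbit_rel (x : X) : {set B * B} :=
  [set p | a (val p.1) x == a (val p.2) x]%SET.

Lemma orbit_rel_equiv (x : X) : is_qball (orbit_rel x).
Proof.
apply/asboolP => g h l; rewrite !inE/= eqxx; split => //.
by move=> /eqP ->.
Qed.

Definition qball_at (x : X) : qball S r := exist _ (orbit_rel x) (orbit_rel_equiv x).

(* A probability measure on the finite set [labelled_qball S r k] is given by
   its values on singletons. *)
Definition local_stat (f : X -> 'I_k) (q : labelled_qball S r k) : R :=
  fine (mu [set x | qball_at x = tag q /\
    forall g : B, f (a (val g) x) = tagged q (qproj (tag q) g)]).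

Definition label_measurable (f : X -> 'I_k) : Prop :=
  forall i, measurable (f @^-1` [set i]).

Definition total_variation (T : finType) (p q : T -> R) : R :=
  \big[Num.max/0]_(A : {set T}) `|\sum_(t in A) p t - \sum_(t in A) q t|.

Definition tv_closure (T : finType) (P : set (T -> R)) : set (T -> R) :=
  [set p | forall e, 0 < e -> exists2 q, P q & total_variation p q < e].

Definition local_stats : set (labelled_qball S r k -> R) :=
  tv_closure [set local_stat f | f in label_measurable].

End local_statistics.

Arguments local_stats {R G} S {d X mu} a r k.

Definition local_global_contains (R : realType) (G : groupType) (S : seq G)
    (d : measure_display) (X : measurableType d) (mu : probability X R)
    (a b : pmp_action G mu) : Prop :=
  forall r k : nat, local_stats S b r k `<=` local_stats S a r k.

Section language.
Context (R : realType) (G : groupType).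

Inductive term (n : nat) :=
| Var of 'I_n
| One
| Fix of G
| Add of term n & term n
| Mul of term n & term n
| Star of term n
| Scale of R[i] & term n
| Act of G & term n.

Inductive qf_formula (n : nat) :=
| ReInner of term n & term n
| ImInner of term n & term n
| Connective (m : nat) (c : 'rV[R]_m -> R) of unif_continuous c
    & ('I_m -> qf_formula n).

End language.

(* An element of L^2 or L^oo is represented by a function; all the operations
   below respect equality almost everywhere. *)
Section structure.
Local Open Scope complex_scope.
Context (R : realType) (G : groupType) (d : measure_display).
Context (X : measurableType d) (mu : probability X R).

Definition Linfty : set (X -> R[i]) :=
  [set f : X -> R[i] | [/\ measurable_fun setT (fun x => complex.Re (f x)),
               measurable_fun setT (fun x => complex.Im (f x)) &
               exists M : R, {ae mu, forall x, `|f x| <= M%:C}]].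

Definition complex_integral (f : X -> R[i]) : R[i] :=
  (\int[mu]_x complex.Re (f x)) +i* (\int[mu]_x complex.Im (f x)).

Definition inner (f g : X -> R[i]) : R[i] :=
  complex_integral (fun x => f x * (g x)^*).

Context (a : pmp_action G mu).

Fixpoint term_eval (n : nat) (v : 'I_n -> X -> R[i]) (t : term R G n) :
    X -> R[i] :=
  match t with
  | Var i => v i
  | One => fun=> 1
  | Fix g => fun x => (a g x == x)%:R
  | Add t1 t2 => fun x => term_eval v t1 x + term_eval v t2 x
  | Mul t1 t2 => fun x => term_eval v t1 x * term_eval v t2 x
  | Star t1 => fun x => (term_eval v t1 x)^*
  | Scale c t1 => fun x => c * term_eval v t1 x
  | Act g t1 => fun x => term_eval v t1 (a (g^-1)%g x)
  end.

Fixpoint qf_eval (n : nat) (v : 'I_n -> X -> R[i]) (psi : qf_formula R G n) : R :=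
  match psi with
  | ReInner t1 t2 => complex.Re (inner (term_eval v t1) (term_eval v t2))
  | ImInner t1 t2 => complex.Im (inner (term_eval v t1) (term_eval v t2))
  | Connective m c _ F => c (\row_j qf_eval v (F j))
  end.

End structure.

(* Boundedness from below is required uniformly over the structures M^+(c), so
   that being a sentence does not depend on the actions being compared. *)
Definition qf_bounded_below (R : realType) (G : groupType) (n : nat)
    (psi : qf_formula R G n) : Prop :=
  exists m : R, forall (d : measure_display) (X : measurableType d)
    (mu : probability X R) (c : pmp_action G mu) (v : 'I_n -> X -> R[i]),
    standard_borel R X -> (forall i, Linfty mu (v i)) -> m <= qf_eval c v psi.

Record sigma1_sentence (R : realType) (G : groupType) := Sigma1 {
  arity : nat ;
  body : qf_formula R G arity ;
  body_bounded_below : qf_bounded_below body }.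

Definition sigma1_value (R : realType) (G : groupType) (d : measure_display)
    (X : measurableType d) (mu : probability X R) (a : pmp_action G mu)
    (phi : sigma1_sentence R G) : R :=
  inf [set qf_eval a v (body phi) |
        v in [set v | forall i, Linfty mu (v i)]].

Record nonprincipal_ultrafilter := NonprincipalUltrafilter {
  uf_sets :> set_system nat ;
  uf_ultra : UltraFilter uf_sets ;
  uf_nonprincipal : forall n, ~ uf_sets [set n] }.

#[global] Existing Instance uf_ultra.

#[global] Instance uf_proper (U : nonprincipal_ultrafilter) :
  ProperFilter (uf_sets U) := @ultra_proper _ _ (uf_ultra U).

Lemma ufT (U : nonprincipal_ultrafilter) : uf_sets U setT.
Proof. exact: filterT. Qed.

Lemma ufI (U : nonprincipal_ultrafilter) (A B : set nat) :
  uf_sets U A -> uf_sets U B -> uf_sets U (A `&` B).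
Proof. exact: filterI. Qed.

Lemma ufS (U : nonprincipal_ultrafilter) (A B : set nat) :
  A `<=` B -> uf_sets U A -> uf_sets U B.
Proof. exact: filterS. Qed.

Lemma uf_not0 (U : nonprincipal_ultrafilter) : ~ uf_sets U set0.
Proof. exact: filter_not_empty. Qed.

Lemma uf_setC (U : nonprincipal_ultrafilter) (A : set nat) :
  uf_sets U (~` A) <-> ~ uf_sets U A.
Proof.
split=> [UnA UA|nUA]; last first.
  by have [|//] := in_ultra_setVsetC A (uf_ultra U).
by have := ufI UA UnA; rewrite setICr => /uf_not0.
Qed.

Lemma uf_cofinite (U : nonprincipal_ultrafilter) (n : nat) :
  uf_sets U [set i | n <= i]%N.
Proof.
elim: n => [|n IH]; first exact: ufS (ufT U).
have /uf_setC Un := @uf_nonprincipal U n.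
apply: ufS (ufI IH Un) => i [/= ni /eqP ain].
by rewrite ltn_neqAle eq_sym ain.
Qed.

Lemma ultra_fmap (T T' : Type) (f : T -> T') (F : set_system T) :
  UltraFilter F -> UltraFilter (fmap f F).
Proof.
move=> UF; split=> [|H PH FH]; first exact: fmap_proper_filter.
apply/seteqP; split=> [A HA|]; last exact: FH.
have [//|FnA] := in_ultra_setVsetC (f @^-1` A) UF.
have := filterI HA (FH (~` A) FnA); rewrite setICr => H0.
by case: (@filter_not_empty _ H PH (H0 _)).
Qed.

Section ultrapower.
Context (d : measure_display) (X : measurableType d).
Variable (U : nonprincipal_ultrafilter).

Definition ultra_eq (x y : nat -> X) : bool :=
  `[< uf_sets U [set i | x i = y i] >].

Let ultra_eq_refl : reflexive ultra_eq.
Proof. by move=> x; apply/asboolP; apply: ufS (ufT U). Qed.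

Let ultra_eq_sym : symmetric ultra_eq.
Proof.
by move=> x y; apply/idP/idP => /asboolP h; apply/asboolP; apply: ufS h.
Qed.

Let ultra_eq_trans : transitive ultra_eq.
Proof.
move=> y x z /asboolP h1 /asboolP h2; apply/asboolP.
by apply: ufS (ufI h1 h2) => i [/= -> ->].
Qed.

Canonical ultra_eq_canonical :=
  EquivRel ultra_eq ultra_eq_refl ultra_eq_sym ultra_eq_trans.

Local Open Scope quotient_scope.

Definition ultrapower : Type := {eq_quot ultra_eq}.
HB.instance Definition _ := Choice.on ultrapower.
HB.instance Definition _ := EqQuotient.on ultrapower.
HB.instance Definition _ := isPointed.Build ultrapower (\pi_ultrapower (fun=> point)).

Definition ultra_class (x : nat -> X) : ultrapower := \pi_ultrapower x.

Definition internal (A : nat -> set X) : set ultrapower :=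
  [set ultra_class x | x in [set x | uf_sets U [set i | A i (x i)]]].

Lemma ultra_classP (x y : nat -> X) :
  ultra_class x = ultra_class y <-> uf_sets U [set i | x i = y i].
Proof.
rewrite /ultra_class; split => [/eqP|h].
  by rewrite eqmodE => /asboolP.
by apply/eqP; rewrite eqmodE; apply/asboolP.
Qed.

Lemma ultra_classW (q : ultrapower) : exists x, q = ultra_class x.
Proof. by exists (repr q); rewrite /ultra_class reprK. Qed.

Lemma internalE (A : nat -> set X) (x : nat -> X) :
  internal A (ultra_class x) <-> uf_sets U [set i | A i (x i)].
Proof.
split=> [[y /= Uy /ultra_classP yx]|h]; last by exists x.
by apply: ufS (ufI Uy yx) => i [/= + <-].
Qed.

Lemma internal0 : internal (fun=> set0) = set0.
Proof.
apply/seteqP; split=> // q; have [x ->] := ultra_classW q.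
by move=> /internalE /=; exact: uf_not0.
Qed.

Lemma internalU (A B : nat -> set X) :
  internal (fun i => A i `|` B i) = internal A `|` internal B.
Proof.
apply/seteqP; split=> q; have [x ->] := ultra_classW q.
  move=> /internalE h; have [|] := pselect (internal A (ultra_class x)).
    by left.
  move=> /internalE /uf_setC nA; right; apply/internalE.
  by apply: ufS (ufI h nA) => i [/= []].
by case=> /internalE h; apply/internalE; apply: ufS h => i /=; [left|right].
Qed.

Lemma internalC (A : nat -> set X) :
  internal (fun i => ~` A i) = ~` internal A.
Proof.
apply/seteqP; split=> q; have [x ->] := ultra_classW q.
  by move=> /internalE /uf_setC h /internalE.
by move=> h; apply/internalE/uf_setC => h'; apply: h; apply/internalE.
Qed.

Lemma internalI (A B : nat -> set X) :
  internal (fun i => A i `&` B i) = internal A `&` internal B.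
Proof.
rewrite -[RHS]setCK setCI -!internalC -internalU -internalC; congr internal.
by apply/funext => i; rewrite setCU !setCK.
Qed.

Lemma internal_sub (A B : nat -> set X) :
  internal A `<=` internal B -> uf_sets U [set i | A i `<=` B i].
Proof.
move=> AB; have [//|/uf_setC h] := pselect (uf_sets U [set i | A i `<=` B i]).
pose x i := get [set y | A i y /\ ~ B i y].
have xP i : ~ A i `<=` B i -> A i (x i) /\ ~ B i (x i).
  move=> /existsNP[y /not_implyP Py].
  by apply: (@getPex X [set y | A i y /\ ~ B i y]); exists y.
have /AB/internalE Bx : internal A (ultra_class x).
  by apply/internalE; apply: ufS h => i /xP[].
suff : uf_sets U set0 by move/uf_not0.
by apply: ufS (ufI h Bx) => i [/= /xP[_ nB] /nB].
Qed.

Definition internal_measurable : set (set ultrapower) :=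
  [set E | exists A : nat -> set X,
    (forall i, measurable (A i)) /\ E = internal A].

Let internal_measurable0 : internal_measurable set0.
Proof. by exists (fun=> set0); rewrite internal0. Qed.

Let internal_measurableU : setU_closed internal_measurable.
Proof.
move=> _ _ [A [mA ->]] [B [mB ->]]; exists (fun i => A i `|` B i).
by split=> [i|]; [exact: measurableU|rewrite internalU].
Qed.

Let internal_measurableC : setC_closed internal_measurable.
Proof.
move=> _ [A [mA ->]]; exists (fun i => ~` A i).
by split=> [i|]; [exact: measurableC|rewrite internalC].
Qed.

Definition internal_display : measure_display. Proof. exact. Qed.

HB.instance Definition _ := isAlgebraOfSets.Build internal_display ultrapower
  internal_measurable0 internal_measurableU internal_measurableC.

Lemma internal_saturation (D : nat -> nat -> set X) :
  (forall n i, D n.+1 i `<=` D n i) ->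
  \bigcap_n internal (D n) = set0 -> exists n, internal (D n) = set0.
Proof.
move=> Ddec D0; apply: contrapT => /forallNP Dn0.
have Ddecle n m i : (n <= m)%N -> D m i `<=` D n i.
  move=> /subnK <-; elim: (m - n)%N => [//|k IH].
  by rewrite addSn; exact: subset_trans (Ddec _ _) IH.
have UD n : uf_sets U [set i | D n i !=set0].
  have [q] : internal (D n) !=set0 by apply/set0P/eqP.
  have [x ->] := ultra_classW q => /internalE.
  by apply: ufS => i Dx; exists (x i).
pose good i n := D n i !=set0.
pose N i := \max_(n < i.+1 | `[< good i n >]) n.
pose x i := get (D (N i) i).
have xP n i : (n <= i)%N -> good i n -> D n i (x i).
  move=> ni gin.
  have ni1 : (n < i.+1)%N by [].
  have nN : (n <= N i)%N.
    by apply: (@leq_bigmax_cond _ _ _ (Ordinal ni1)); apply/asboolP.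
  have gN : good i (N i).
    have [j /asboolP gj Nj] : {j : 'I_i.+1 | `[< good i j >] & N i = j}.
      apply: (@eq_bigmax_cond _ _ (fun j : 'I_i.+1 => nat_of_ord j)).
      by apply/card_gt0P; exists (Ordinal ni1); apply/asboolP.
    by rewrite Nj.
  by apply: (Ddecle _ _ _ nN); exact: getPex.
suff : (\bigcap_n internal (D n)) (ultra_class x) by rewrite D0.
move=> n _; apply/internalE.
by apply: ufS (ufI (uf_cofinite U n) (UD n)) => i [/= ni]; exact: xP.
Qed.

End ultrapower.

Arguments ultra_class {d X} U x.
Arguments internal {d X} U A.
Arguments internal0 {d} X U.

Section ultraproduct_measure.
Context (R : realType) (d : measure_display) (X : measurableType d).
Variables (mu : probability X R) (U : nonprincipal_ultrafilter).
Local Open Scope ereal_scope.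

Definition internal_content (E : set (ultrapower X U)) : \bar R :=
  let A := xget (fun=> set0)
    [set A : nat -> set X | (forall i, measurable (A i)) /\ E = internal U A] in
  lim (mu (A i) @[i --> uf_sets U]).

Lemma ultra_is_cvg (A : nat -> set X) : (forall i, measurable (A i)) ->
  exists2 l : R, (0 <= l)%R & mu (A i) @[i --> uf_sets U] --> l%:E.
Proof.
move=> mA; pose u i := fine (mu (A i)).
have uE i : mu (A i) = (u i)%:E by rewrite fineK// fin_num_measure.
have u01 i : (0 <= u i <= 1)%R.
  by rewrite -!lee_fin -uE measure_ge0/=; exact: probability_le1.
have Uu : fmap u (uf_sets U) `[0%R, 1%R]%classic.
  by apply: ufS (ufT U) => i _ /=; rewrite in_itv/= u01.
have := @segment_compact R 0%R 1%R; rewrite compact_ultra.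
case/(_ (fmap u (uf_sets U)) (ultra_fmap u (uf_ultra U)) Uu).
move=> l [/= l01 ul]; exists l; first by move: l01; rewrite in_itv/= => /andP[].
apply: cvg_EFin; last exact: ul.
by apply: ufS (ufT U) => i _ /=; rewrite uE.
Qed.

Lemma internal_content_cvg (A : nat -> set X) : (forall i, measurable (A i)) ->
  mu (A i) @[i --> uf_sets U] --> internal_content (internal U A).
Proof.
move=> mA; rewrite /internal_content; set P := [set B | _]; set B := xget _ _.
have [mB AB] : P B by apply: xgetPex; exists A.
have [l _ Bl] := ultra_is_cvg mB.
rewrite (cvg_lim _ Bl)//; apply: cvg_trans Bl; apply: near_eq_cvg.
have AsubB : internal U A `<=` internal U B by rewrite AB.
have BsubA : internal U B `<=` internal U A by rewrite AB.
apply: ufS (ufI (internal_sub AsubB) (internal_sub BsubA)) => i [/= ab ba].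
by congr (mu _); apply/seteqP; split.
Qed.

Lemma internal_contentE (A : nat -> set X) : (forall i, measurable (A i)) ->
  internal_content (internal U A) = lim (mu (A i) @[i --> uf_sets U]).
Proof. by move=> mA; apply/esym/cvg_lim => //; exact: internal_content_cvg. Qed.

Let internal_content_fin (A : nat -> set X) : (forall i, measurable (A i)) ->
  internal_content (internal U A) \is a fin_num.
Proof.
move=> mA; have [l _ Al] := ultra_is_cvg mA.
by rewrite internal_contentE// (cvg_lim _ Al).
Qed.

Let internal_content0 : internal_content set0 = 0.
Proof.
rewrite -(internal0 X U) internal_contentE; last by move=> _; exact: measurable0.
by under eq_fun do rewrite measure0; exact: lim_cst.
Qed.

Let internal_content_ge0 (E : set (ultrapower X U)) : 0 <= internal_content E.
Proof.
rewrite /internal_content; set B := xget _ _.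
have mB i : measurable (B i).
  by rewrite /B; case: xgetP => [A _ [mA _]|_]; [exact: mA|exact: measurable0].
by have [l l0 Bl] := ultra_is_cvg mB; rewrite (cvg_lim _ Bl)// lee_fin.
Qed.

Let internal_content_additive : measure_function.semi_additive internal_content.
Proof.
apply/(additive2P internal_content0) => // E F [A [mA ->]] [B [mB ->]] AB0.
rewrite -internalU internal_contentE; last by move=> i; exact: measurableU.
apply/cvg_lim => //.
apply: (cvg_trans _ (cvgeD (fin_num_adde_defr _ (internal_content_fin mA))
  (internal_content_cvg mA) (internal_content_cvg mB))).
apply: near_eq_cvg.
have sub0 : internal U (fun i => A i `&` B i) `<=` internal U (fun=> set0).
  by rewrite internalI AB0.
apply: ufS (internal_sub sub0) => i /= AB.
by rewrite measureU//; apply/seteqP; split.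
Qed.

HB.instance Definition _ := isContent.Build _ _ _ internal_content
  internal_content_ge0 internal_content_additive.

Let internal_content_sigma_subadditive :
  measurable_subset_sigma_subadditive internal_content.
Proof.
move=> E F mF [A [mA EA]] EF.
pose P n C := (forall i : nat, d.-measurable (C i)) /\ F n = internal U C.
have [C CP] : {C : nat -> nat -> set X & forall n, P n (C n)}.
  by apply: (@choice _ _ P) => n; have [Cn CnP] := mF n; exists Cn.
pose D n i := A i `\` \big[setU/set0]_(k < n) C k i.
have DE n : internal U (D n) = E `\` \big[setU/set0]_(k < n) F k.
  rewrite /D [LHS]internalI internalC -EA; congr (_ `&` ~` _).
  elim: n => [|n IH].
    by rewrite big_ord0 -(internal0 X U); congr internal; apply/funext => i;
      rewrite big_ord0.
  rewrite big_ord_recr/= -IH (CP n).2 -internalU; congr internal.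
  by apply/funext => i; rewrite big_ord_recr.
have Ddec n i : D n.+1 i `<=` D n i.
  by apply: setDS; rewrite big_ord_recr/=; exact: subsetUl.
have D0 : \bigcap_n internal U (D n) = set0.
  apply/seteqP; split=> // q Dq.
  have [n _ Fnq] : (\bigcup_n F n) q.
    by apply: EF; have := Dq 0%N I; rewrite DE => -[].
  have := Dq n.+1 I; rewrite DE big_ord_recr/= => -[_]; apply; right.
  exact: Fnq.
have [n] := internal_saturation Ddec D0.
rewrite DE setD_eq0 => En.
apply: (@le_trans _ _ (\sum_(k < n) internal_content (F k))).
  by apply: content_subadditive => //; exists A.
by rewrite -(big_mkord xpredT (fun k => internal_content (F k)));
  exact: nneseries_lim_ge.
Qed.

HB.instance Definition _ := Content_SigmaSubAdditive_isMeasure.Build _ _ _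
  internal_content internal_content_sigma_subadditive.

(* The completion of the measure generated by [internal_content]: Caratheodory's
   sigma-algebra of the corresponding outer measure is complete. *)
Definition ultra_measurableType : measurableType _ :=
  caratheodory_type (mu_ext internal_content).

Definition ultra_measure : {measure set ultra_measurableType -> \bar R} :=
  @completed_measure_extension _ _ _ internal_content.

Lemma ultra_measure_complete : measure_is_complete ultra_measure.
Proof. exact: measure_is_complete_caratheodory. Qed.

Lemma internal_ultra_measurable (A : nat -> set X) :
  (forall i, measurable (A i)) ->
  measurable (internal U A : set ultra_measurableType).
Proof.
by move=> mA; apply: (caratheodory_measurable_mu_ext internal_content); exists A.
Qed.

Lemma ultra_measureE (A : nat -> set X) : (forall i, measurable (A i)) ->
  ultra_measure (internal U A) = lim (mu (A i) @[i --> uf_sets U]).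
Proof.
move=> mA; rewrite -internal_contentE//.
by apply: (measurable_mu_extE internal_content); exists A.
Qed.

End ultraproduct_measure.

Definition ultra_act (R : realType) (G : groupType) (d : measure_display)
    (X : measurableType d) (mu : probability X R) (U : nonprincipal_ultrafilter)
    (a : pmp_action G mu) (g : G) (q : ultrapower X U) : ultrapower X U :=
  ultra_class U (fun i => a g (repr q i)).

Lemma ultra_actE (R : realType) (G : groupType) (d : measure_display)
    (X : measurableType d) (mu : probability X R) (U : nonprincipal_ultrafilter)
    (a : pmp_action G mu) (g : G) (x : nat -> X) :
  ultra_act a g (ultra_class U x) = ultra_class U (fun i => a g (x i)).
Proof.
apply/ultra_classP.
have /ultra_classP : ultra_class U (repr (ultra_class U x)) = ultra_class U x.
  by rewrite /ultra_class reprK.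
by apply: ufS => i /= ->.
Qed.

(* A measure preserving map is onto in the measure-theoretic sense: a
   measurable set missing its range is null. *)
Definition stab_preserving_weakly_contains (R : realType) (G : groupType)
    (d : measure_display) (X : measurableType d) (mu : probability X R)
    (a b : pmp_action G mu) : Prop :=
  exists (U : nonprincipal_ultrafilter) (f : ultra_measurableType mu U -> X),
    [/\ measurable_fun setT f,
        forall A : set X, measurable A -> ultra_measure mu U (f @^-1` A) = mu A,
        {ae ultra_measure mu U, forall q, forall g : G,
          f (ultra_act a g q) = b g (f q)} &
        {ae ultra_measure mu U, forall q, forall g : G,
          ultra_act a g q = q <-> b g (f q) = f q}].

(* Main.v *)
From HB Require Import structures.
From mathcomp Require Import all_boot all_order all_algebra.
From mathcomp Require Import complex.
From mathcomp Require Import all_classical all_reals all_analysis.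
From mathcomp Require Import measurable_realfun.
From mathcomp Require Import ring lra.
Require Import Defs.

(** Why the three conditions are equivalent.

    The link between them is the labelled ball (the _pattern_) seen from a point
    of an action with a finite labelling: local statistics are laws of patterns,
    terms evaluated at step functions are functions of patterns, and patterns
    pass to ultralimits.

    From local-global containment to Sigma_1-sentences.  A bounded function on
    [b] is uniformly close to a step function, that is, to a finite labelling
    followed by a map to the complex numbers, and terms are Lipschitz on bounded
    functions.  The integrand of an inner product of terms at a step function
    reads only a ball of fixed radius ([local_map_inner]), so a labelling of [a]
    with nearly the same statistics gives nearly the same inner products
    ([local_global_inner_approximable]), hence nearly the same value of every
    quantifier-free formula ([qf_modulus]).

    From Sigma_1-sentences to local statistics.  The distance to the values that
    finitely many inner products take at given functions on [b] is a sentence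
    vanishing in [b], so these values are approximated in [a]
    ([sigma1_inner_approximable]).  This is applied to the indicators of the
    patterns of a labelling of [b].  They satisfy finitely many equations, and
    functions on [a] which nearly satisfy these equations can be rounded to a
    labelling of [a] whose pattern indicators are close to them in the mean
    ([decode_defect]).  Variables range over functions without a common bound;
    the equation [z * z = z] controls them where they are large.

    From a stabilizer preserving factor map to local statistics.  A labelling of
    [b] is pulled back to the ultrapower and replaced, off a small set, by an
    internal one.  Equivariance and preservation of stabilizers make the
    ultralimit of the patterns upstairs equal to the pattern of the image point
    ([factor_pattern]), and measures of internal sets are ultralimits.

    From local statistics to a factor map.  Let [A] be a countable family of sets
    containing the translates of a basis of a Polish model of [X] and the
    fixed point sets of [b].  Labelling points by the first [n] bits of their
    itinerary through [A], and choosing a point for each itinerary, local-global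
    containment gives finite valued maps [s n : X -> X] that look more and more
    like a factor map from [a] to [b] as far as [A] can tell
    ([approximating_maps]).  The ultralimit of the points [s n (x n)] exists for
    almost every class of sequences, because the basic sets of small diameter
    cover [X]; its joint law with the sets of [A] is determined on open sets
    ([ultralimit_law]), and this makes it measure preserving, equivariant and
    stabilizer preserving. *)

Import Order.TTheory GRing.Theory Num.Theory.
Import numFieldNormedType.Exports.
Set Implicit Arguments.
Unset Strict Implicit.
Unset Printing Implicit Defensive.
Local Open Scope classical_set_scope.
Local Open Scope ring_scope.

(** * Balls in marked groups and standard Borel spaces *)

Lemma measurable_preimage d d' (X : measurableType d) (Y : measurableType d')
    (f : X -> Y) (A : set Y) :
  measurable_fun setT f -> measurable A -> measurable (f @^-1` A).
Proof. by move=> mf mA; have := mf measurableT A mA; rewrite setTI. Qed.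

Section marked_group.
Context (G : groupType) (S : seq G).

Lemma cayley_ball_mono (r s : nat) : (r <= s)%N ->
  {subset cayley_ball S r <= cayley_ball S s}.
Proof.
move=> /subnK <-; elim: (s - r)%N => [//|n IH] g /IH gn.
by rewrite addSn/= mem_cat gn.
Qed.

Lemma cayley_ball_word (w : seq G) : {subset w <= S} ->
  (\big[*%g/1%g]_(s <- w) s) \in cayley_ball S (size w).
Proof.
elim: w => [_|s w IH sw]; first by rewrite big_nil inE.
rewrite big_cons/= mem_cat; apply/orP; right; apply/allpairsP.
exists (s, \big[*%g/1%g]_(s <- w) s); split=> //=.
  by apply: sw; rewrite mem_head.
by apply: IH => t tw; apply: sw; rewrite inE tw orbT.
Qed.

Hypothesis HS : marking S.

Lemma near_cayley_ball (g : G) : \forall r \near \oo, g \in cayley_ball S r.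
Proof.
have [w [wS ->]] := HS.2 g; exists (size w) => // r /= wr.
exact: cayley_ball_mono (cayley_ball_word wS).
Qed.

Lemma marking_countable : exists e : nat -> G, forall g, exists n, e n = g.
Proof.
exists (fun n => if unpickle n is Some (r, i) then nth 1%g (cayley_ball S r) i
                 else 1%g) => g.
have [r _ /(_ r (leqnn r)) gr] := near_cayley_ball g.
by exists (pickle (r, index g (cayley_ball S r))); rewrite pickleK nth_index.
Qed.

End marked_group.

Section standard_borel_facts.

(** The point of [P] excludes the empty basis, so the enumeration can be total. *)
Lemma second_countable_basis (P : topologicalType) (p : P) :
  @second_countable P -> exists B : nat -> set P,
  (forall i, open (B i)) /\
  forall V x, open V -> V x -> exists2 i, B i x & B i `<=` V.
Proof.
case=> B /pfcard_geP[->|[e]] [Bo Bb].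
  by have [C []] := Bb p setT filterT.
exists e; split=> [i|V x oV Vx].
  by apply: Bo; apply: (@funS _ _ _ _ e).
have [C [BC Cx] CV] := Bb x V (open_nbhs_nbhs (conj oV Vx)).
have [i _ iC] := @surj _ _ _ _ e C BC.
by exists i; rewrite iC.
Qed.

(** Regularity of pseudometric spaces, in the form that survives limits: a limit
    of points of [B i] is only known to lie in the closure of [B i]. *)
Lemma basis_regular (R : realType) (P : pseudoMetricType R) (B : nat -> set P) :
  (forall V x, open V -> V x -> exists2 i, B i x & B i `<=` V) ->
  forall V x, open V -> V x -> exists2 i, B i x & closure (B i) `<=` V.
Proof.
move=> Bb V x oV Vx.
have /nbhs_ballP[e /= e0 eV] := open_nbhs_nbhs (conj oV Vx).
have e2 : 0 < e / 2 by rewrite divr_gt0.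
have [i Bx Bi] := Bb _ _ (open_interior (ball x (e / 2)))
  (nbhs_singleton (nbhs_interior (nbhsx_ballx x _ e2))).
exists i => // y /(_ _ (nbhsx_ballx y _ e2))[z [Bz yz]].
apply: eV; rewrite (splitr e); apply: ball_triangle (ball_sym yz).
exact: interior_subset (Bi _ Bz).
Qed.

Lemma basis_separates (P : topologicalType) (B : nat -> set P) :
  hausdorff_space P ->
  (forall V x, open V -> V x -> exists2 i, B i x & B i `<=` V) ->
  forall x y, (forall i, B i x <-> B i y) -> x = y.
Proof.
move=> hP Bb x y Bxy; apply: hP => V W.
rewrite nbhsE => -[V' [oV' V'x] V'V] /nbhs_singleton Wy.
have [i Bi BiV] := Bb _ _ oV' V'x.
by exists y; split=> //; apply/V'V/BiV/Bxy.
Qed.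

(** The diagonal is a countable intersection of basic conditions, because a
    countable basis separates points. *)
Lemma standard_borel_eq_measurable (R : realType) (d : measure_display)
    (X : measurableType d) (f g : X -> X) : standard_borel R X ->
  measurable_fun setT f -> measurable_fun setT g ->
  measurable [set x | f x = g x].
Proof.
move=> [P [phi [hP sP bphi mphi]]] mf mg.
have [B [Bo Bb]] := second_countable_basis (phi point) sP.
have mB i : measurable (phi @^-1` B i).
  by apply/mphi; apply: sub_sigma_algebra; exact: Bo.
pose E i := [set x | B i (phi (f x)) <-> B i (phi (g x))].
have mE i : measurable (E i).
  rewrite (_ : E i = (f @^-1` (phi @^-1` B i) `&` g @^-1` (phi @^-1` B i)) `|`
      (~` (f @^-1` (phi @^-1` B i)) `&` ~` (g @^-1` (phi @^-1` B i)))).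
    by apply: measurableU; apply: measurableI;
      [| |apply: measurableC|apply: measurableC]; exact: measurable_preimage.
  apply/seteqP; split=> x; rewrite /E/=.
    by have [Bf|Bf] := pselect (B i (phi (f x))) => fg; [left|right];
      split=> //; [exact/fg|move=> /fg].
  by case=> -[].
rewrite (_ : [set x | _] = \bigcap_i E i); first exact: bigcapT_measurable.
apply/seteqP; split=> x /= => [fgx i _|Ex]; first by rewrite /E/= fgx.
apply: (bij_inj bphi); apply: basis_separates hP Bb _ _ _ => i.
exact: Ex.
Qed.

End standard_borel_facts.

(** * Maps with finitely many values *)

Section probability_tools.
Context (R : realType) (d : measure_display) (X : measurableType d).
Context (mu : probability X R).

Lemma prE (A : set X) : measurable A -> mu A = (fine (mu A))%:E.
Proof. by move=> mA; rewrite fineK// fin_num_measure. Qed.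

Lemma ae_bounded_integrable (f : X -> R) (M : R) : measurable_fun setT f ->
  {ae mu, forall x, `|f x| <= M} -> mu.-integrable setT (EFin \o f).
Proof.
move=> mf fM; apply/integrableP; split; first exact/measurable_EFinP.
apply: (@le_lt_trans _ _ (\int[mu]_x (`|M|)%:E)%E).
  apply: ae_ge0_le_integral => //=.
  - by do 2 apply: measurableT_comp => //.
  - by apply: filterS fM => x fxM _; rewrite lee_fin (le_trans fxM)// ler_norm.
by rewrite integral_cst//= probability_setT mule1 ltry.
Qed.

Lemma finite_preimage_measurable (T : finType) (h : X -> T) (A : set T) :
  (forall t, measurable (h @^-1` [set t])) -> measurable (h @^-1` A).
Proof.
move=> mh; rewrite (_ : h @^-1` A = \bigcup_(t in A) h @^-1` [set t]).
  by apply: fin_bigcup_measurable.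
by apply/seteqP; split=> [x Ax|x [t At /= ->]//]; exists (h x).
Qed.

Lemma finite_measurable (T : finType) (h : X -> T) (H : T -> R) :
  (forall t, measurable (h @^-1` [set t])) -> measurable_fun setT (H \o h).
Proof.
move=> mh _ Y mY; rewrite setTI comp_preimage.
exact: finite_preimage_measurable.
Qed.

Lemma Rintegral_finite (T : finType) (h : X -> T) (H : T -> R) :
  (forall t, measurable (h @^-1` [set t])) ->
  \int[mu]_x H (h x) = \sum_t H t * fine (mu (h @^-1` [set t])).
Proof.
move=> mh; rewrite /Rintegral.
rewrite (eq_integral (fun x => \sum_(t : T) (H t)%:E * (\1_(h @^-1` [set t]) x)%:E)%E).
  rewrite integral_sum//= => [|t]; last first.
    by apply: integrableZl => //; exact: integrable_indic.
  rewrite (eq_bigr (fun t => (H t * fine (mu (h @^-1` [set t])))%:E)) => [|t _].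
    by rewrite sumEFin.
  rewrite integralZl//; last exact: integrable_indic.
  by rewrite integral_indic// setIT EFinM -prE.
move=> x _; rewrite (bigD1 (h x))//= big1 => [|t tx].
  by rewrite adde0 indicE mem_set// mule1.
by rewrite indicE memNset ?mule0// => /= hx; rewrite hx eqxx in tx.
Qed.

Lemma pr_Rintegral (A : set X) : measurable A ->
  \int[mu]_x (\1_A x) = fine (mu A).
Proof. by move=> mA; rewrite /Rintegral integral_indic// setIT. Qed.

Lemma pr_finite (T : finType) (h : X -> T) (A : {pred T}) :
  (forall t, measurable (h @^-1` [set t])) ->
  fine (mu [set x | h x \in A]) = \sum_(t in A) fine (mu (h @^-1` [set t])).
Proof.
move=> mh; rewrite -pr_Rintegral; last first.
  exact: (@finite_preimage_measurable _ h [set t | t \in A]).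
rewrite (@eq_Rintegral _ _ _ mu _ (fun x => (h x \in A)%:R)) => [|x _]; last first.
  rewrite indicE; congr (nat_of_bool _)%:R.
  by apply/idP/idP => [/set_mem|?]//; exact: mem_set.
rewrite (Rintegral_finite (fun t => (t \in A)%:R))// [RHS]big_mkcond/=.
by apply: eq_bigr => t _; case: (t \in A); rewrite ?mul1r ?mul0r.
Qed.

Lemma measurable_forall (I : finType) (A : I -> set X) :
  (forall i, measurable (A i)) -> measurable [set x | forall i, A i x].
Proof.
move=> mA; rewrite (_ : [set x | _] = \bigcap_i A i).
  by apply: fin_bigcap_measurable.
by apply/seteqP; split=> x /= Ax i; [move=> _|]; exact: Ax.
Qed.

Lemma set_asbool (A : set X) : [set x | `[< A x >]] = A.
Proof. by apply/seteqP; split=> x /=; [move/asboolP|move=> ?; apply/asboolP]. Qed.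

Lemma finfun_measurable (I : finType) (p : I -> X -> bool) :
  (forall i, measurable [set x | p i x]) -> forall t : {ffun I -> bool},
  measurable ((fun x => [ffun i => p i x]) @^-1` [set t]).
Proof.
move=> mp t; rewrite (_ : _ @^-1` _ = [set x | forall i, p i x = t i]).
  apply: measurable_forall => i; case: (t i); first exact: mp.
  rewrite [X in measurable X](_ : _ = ~` [set x | p i x]); first exact: measurableC.
  by apply/seteqP; split=> x /=; case: (p i x).
apply/seteqP; split=> x /=; first by move=> <- i; rewrite ffunE.
by move=> px; apply/ffunP => i; rewrite ffunE.
Qed.

End probability_tools.

(** * Patterns and local statistics *)

Section patterns.
Context (R : realType) (G : groupType) (S : seq G) (d : measure_display).
Context (X : measurableType d) (mu : probability X R).
Implicit Types (c : pmp_action G mu) (x : X).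

(** The labelled ball of radius [r] seen from [x]; local statistics are its law.
    A class of the quotient ball is labelled through any of its elements. *)
Definition pattern c (k : nat) (f : X -> 'I_k) (r : nat) (x : X) :
    labelled_qball S r k :=
  Tagged (fun Q => {ffun qquot Q -> 'I_k})
    [ffun C : qquot (qball_at S c r x) =>
       if [pick g | qproj (qball_at S c r x) g == C] is Some g
       then f (c (val g) x) else f x].

Context (k : nat) (f : X -> 'I_k) (r : nat).
Notation B := (ballT S r).

Lemma pattern_tag c x (g h : B) :
  ((g, h) \in val (tag (pattern c f r x))) = (c (val g) x == c (val h) x).
Proof. by rewrite inE. Qed.

Lemma pattern_label c x (g : B) :
  tagged (pattern c f r x) (qproj (tag (pattern c f r x)) g) = f (c (val g) x).
Proof.
rewrite ffunE; case: pickP => [h /eqP|/(_ g)]; last by rewrite eqxx.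
move=> /(congr1 val)/= hg.
have : g \in qclass (qball_at S c r x) g by rewrite !inE eqxx.
by rewrite -hg !inE => /eqP ->.
Qed.

Lemma patternP c x (q : labelled_qball S r k) :
  pattern c f r x = q <-> qball_at S c r x = tag q /\
    forall g : B, f (c (val g) x) = tagged q (qproj (tag q) g).
Proof.
split=> [<-|]; first by split=> // g; rewrite pattern_label.
case: q => Q h [/= QE]; subst Q => hE.
congr (existT _ _ _); apply/ffunP => -[C imC].
have /imsetP[g _ Cg] := imC.
have -> : exist _ C imC = qproj (qball_at S c r x) g by exact: val_inj.
by rewrite -hE -pattern_label.
Qed.

Lemma local_statE c (q : labelled_qball S r k) :
  local_stat c f q = fine (mu (pattern c f r @^-1` [set q])).
Proof.
rewrite /local_stat; congr (fine (mu _)).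
by apply/seteqP; split=> x /patternP.
Qed.

Hypothesis HX : standard_borel R X.

Lemma pattern_measurable c : label_measurable f ->
  forall q, measurable (pattern c f r @^-1` [set q]).
Proof.
move=> mf q; have mc g := act_measurable c g.
rewrite (_ : _ @^-1` _ = [set x | forall p : B * B,
      ((c (val p.1) x = c (val p.2) x) <-> p \in val (tag q))] `&`
    [set x | forall g : B, (f (c (val g) x) = tagged q (qproj (tag q) g))]).
  apply: measurableI; last first.
    apply: measurable_forall => g.
    exact: (measurable_preimage (mc (val g)) (mf (tagged q (qproj (tag q) g)))).
  apply: measurable_forall => p.
  have mE : measurable [set x | c (val p.1) x = c (val p.2) x].
    exact: standard_borel_eq_measurable HX (mc _) (mc _).
  have [pq|pq] := boolP (p \in val (tag q)).
    rewrite [X in measurable X](_ : _ = [set x | c (val p.1) x = c (val p.2) x])//.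
    by apply/seteqP; split=> x /= => [[_ h]|]; [exact: h|].
  rewrite [X in measurable X](_ : _ = ~` [set x | c (val p.1) x = c (val p.2) x]).
    exact: measurableC.
  by apply/seteqP; split=> x /= => [[h _] /h//|nh].
apply/seteqP; split=> x /=.
  move=> /patternP[Qx fx]; split=> // p; rewrite -Qx inE.
  by split=> [->|/eqP].
move=> [Qx fx]; apply/patternP; split=> //; apply/val_inj/setP => p.
by rewrite inE; apply/eqP/idP => /Qx.
Qed.

End patterns.

Section total_variation_facts.
Context (R : realType) (T : finType).
Implicit Types p q : T -> R.

Lemma tv_event p q (A : {set T}) :
  `|\sum_(t in A) p t - \sum_(t in A) q t| <= total_variation p q.
Proof. exact: le_bigmax. Qed.

Lemma tv_lt p q (e : R) : 0 < e ->
  (forall A : {set T}, `|\sum_(t in A) p t - \sum_(t in A) q t| < e) ->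
  total_variation p q < e.
Proof. by move=> e0 h; apply/bigmax_ltP. Qed.

Lemma tv_le_sum p q (e : R) : 0 < e ->
  \sum_t `|p t - q t| < e -> total_variation p q < e.
Proof.
move=> e0 pq; apply: tv_lt => // A; rewrite -sumrB.
apply: le_lt_trans (ler_norm_sum _ _ _) _; apply: le_lt_trans pq.
by rewrite big_mkcond/=; apply: ler_sum => t _; case: ifP.
Qed.

Lemma tv_refl p (e : R) : 0 < e -> total_variation p p < e.
Proof. by move=> e0; apply: tv_lt => // A; rewrite subrr normr0. Qed.

Lemma tv_trans q p s (e1 e2 : R) :
  total_variation p q < e1 -> total_variation q s < e2 ->
  total_variation p s < e1 + e2.
Proof.
have tv0 (u v : T -> R) : 0 <= total_variation u v.
  exact: le_trans (normr_ge0 _) (tv_event u v finset.set0).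
move=> pq qs; apply: tv_lt => [|A].
  by apply: addr_gt0; [apply: le_lt_trans (tv0 _ _) pq|apply: le_lt_trans (tv0 _ _) qs].
rewrite (le_lt_trans (ler_distD (\sum_(t in A) q t) _ _))// ltrD//.
  exact: le_lt_trans (tv_event _ _ _) pq.
exact: le_lt_trans (tv_event _ _ _) qs.
Qed.

Lemma tv_point p q t : `|p t - q t| <= total_variation p q.
Proof. by have := tv_event p q [set t]%SET; rewrite !big_set1. Qed.

End total_variation_facts.

Section local_functions.
Context (R : realType) (G : groupType) (S : seq G) (d : measure_display).
Context (X : measurableType d) (mu : probability X R).

(** Local dependence on an action [c], on a labelling [s] and on a point: for all
    large radii, only the labelled ball at the point matters.  Labellings are
    tested through [pi \o f] with [f] finite valued and [pi] arbitrary, so that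
    [T] can be infinite (complex vectors, or the points of [X] themselves) and the
    same radius serves all finite factorizations. *)
Definition local_map (T V : Type) (E : pmp_action G mu -> (X -> T) -> X -> V) :=
  \forall r \near \oo, forall k (pi : 'I_k -> T),
    exists H : labelled_qball S r k -> V,
      forall c (f : X -> 'I_k) x, E c (pi \o f) x = H (pattern S c f r x).

Hypothesis HS : marking S.

Lemma local_map_label (T : Type) (g : G) :
  local_map (fun c (s : X -> T) x => s (c g x)).
Proof.
apply: filterS (near_cayley_ball HS g) => r gr k pi.
exists (fun q : labelled_qball S r k =>
  pi (tagged q (qproj (tag q) (SeqSub gr)))) => c f x.
by rewrite pattern_label.
Qed.

Lemma local_map_eq (T : Type) (g h : G) :
  local_map (fun c (s : X -> T) x => c g x == c h x).
Proof.
apply: filterS2 (near_cayley_ball HS g) (near_cayley_ball HS h) => r gr hr k pi.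
exists (fun q : labelled_qball S r k =>
  (SeqSub gr, SeqSub hr) \in val (tag q)) => c f x.
by rewrite pattern_tag.
Qed.

Lemma local_map_cst (T V : Type) (v : V) : local_map (fun c (s : X -> T) x => v).
Proof. by apply: nearW => r k pi; exists (fun=> v). Qed.

Lemma local_map_comp (T V W : Type) (op : V -> W) E :
  @local_map T V E -> local_map (fun c s x => op (E c s x)).
Proof.
apply: filterS => r HE k pi; have [H EH] := HE k pi.
by exists (op \o H) => c f x; rewrite EH.
Qed.

Lemma local_map_comp2 (T V V' W : Type) (op : V -> V' -> W) E E' :
  @local_map T V E -> @local_map T V' E' ->
  local_map (fun c s x => op (E c s x) (E' c s x)).
Proof.
apply: filterS2 => r HE HE' k pi.
have [H EH] := HE k pi; have [H' EH'] := HE' k pi.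
by exists (fun q => op (H q) (H' q)) => c f x; rewrite EH EH'.
Qed.

Hypothesis HX : standard_borel R X.

Lemma local_stat_event (c : pmp_action G mu) k (f : X -> 'I_k) r
    (A : {set labelled_qball S r k}) : label_measurable f ->
  fine (mu [set x | pattern S c f r x \in A]) = \sum_(q in A) local_stat c f q.
Proof.
move=> mf; rewrite (pr_finite mu _ (pattern_measurable HX c mf)).
by apply: eq_bigr => q _; rewrite local_statE.
Qed.

(** A local event is a set of labelled balls, so its probabilities differ by at
    most the total variation distance, whatever the number of labels. *)
Lemma local_map_event (a b : pmp_action G mu) (T : Type) E : @local_map T bool E ->
  \forall r \near \oo, forall k (pi : 'I_k -> T) (f f' : X -> 'I_k) (e : R),
    label_measurable f -> label_measurable f' ->
    total_variation (@local_stat _ _ S _ _ _ b r _ f) (local_stat a f') < e ->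
    `|fine (mu [set x | E b (pi \o f) x]) -
      fine (mu [set x | E a (pi \o f') x])| < e.
Proof.
apply: filterS => r HE k pi f f' e mf mf' tve; have [H EH] := HE k pi.
have EA c g : [set x | E c (pi \o g) x] =
    [set x | pattern S c g r x \in [set q | H q]%SET].
  by apply/seteqP; split=> x; rewrite /= EH inE.
rewrite !EA !local_stat_event//.
exact: le_lt_trans (tv_event _ _ _) tve.
Qed.

(** The integral is a finite combination of the statistics.  The coefficients
    depend on [pi] but not on [f], so the closeness required is uniform in the
    labellings. *)
Lemma local_map_integral (a b : pmp_action G mu) (T : Type) E : @local_map T R E ->
  \forall r \near \oo, forall k (pi : 'I_k -> T) (e : R), 0 < e ->
    \forall e' \near 0^'+, forall f f' : X -> 'I_k,
    label_measurable f -> label_measurable f' ->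
    total_variation (@local_stat _ _ S _ _ _ b r _ f) (local_stat a f') < e' ->
    `|\int[mu]_x E b (pi \o f) x - \int[mu]_x E a (pi \o f') x| < e.
Proof.
apply: filterS => r HE k pi e e0; have [H EH] := HE k pi.
have EI c g : label_measurable g -> \int[mu]_x E c (pi \o g) x =
    \sum_q H q * local_stat c g q.
  move=> mg; under eq_Rintegral do rewrite EH.
  rewrite (Rintegral_finite mu _ (pattern_measurable HX c mg)).
  by apply: eq_bigr => q _; rewrite local_statE.
pose M := \sum_q `|H q| + 1.
have M0 : 0 < M by rewrite ltr_wpDl// sumr_ge0.
near=> e'.
have e'M : e' < e / M by near: e'; apply: nbhs_right_lt; rewrite divr_gt0.
move=> f f' mf mf' tve; rewrite !EI// -sumrB.
apply: le_lt_trans (ler_norm_sum _ _ _) _.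
apply: (@le_lt_trans _ _ (\sum_q `|H q| * (e / M))).
  apply: ler_sum => q _; rewrite -mulrBr normrM ler_wpM2l//.
  exact: le_trans (tv_point _ _ _) (ltW (lt_trans tve e'M)).
by rewrite -mulr_suml mulrCA gtr_pMr// ltr_pdivrMr// mul1r ltrDl.
Unshelve. all: by end_near. Qed.

Lemma local_global_approx (a b : pmp_action G mu) : local_global_contains S a b ->
  forall r k (f : X -> 'I_k) (e : R), label_measurable f -> 0 < e ->
  exists2 f' : X -> 'I_k, label_measurable f' &
    total_variation (@local_stat _ _ S _ _ _ b r _ f) (local_stat a f') < e.
Proof.
move=> ab r k f e mf e0.
have bf : local_stats S b r k (local_stat b f).
  by move=> e' e'0; exists (local_stat b f); [exists f|exact: tv_refl].
by have [_ [f' mf' <-]] := ab _ _ _ bf e e0; exists f'.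
Qed.

(** The statistics of labellings of [b] suffice: local statistics are closed. *)
Lemma local_global_intro (a b : pmp_action G mu) :
  (forall r k (f : X -> 'I_k) (e : R), label_measurable f -> 0 < e ->
    exists2 f' : X -> 'I_k, label_measurable f' &
    total_variation (@local_stat _ _ S _ _ _ b r _ f) (local_stat a f') < e) ->
  local_global_contains S a b.
Proof.
move=> ab r k p bp e e0; have e2 : 0 < e / 2 by rewrite divr_gt0.
have [_ [f mf <-] pf] := bp _ e2.
have [f' mf' ff'] := ab r k f _ mf e2.
exists (local_stat a f'); first by exists f'.
by rewrite (splitr e); exact: tv_trans pf ff'.
Qed.

End local_functions.

(** * Bounded complex functions *)

Section modulus.
Context (R : realType).
Implicit Types z w : R[i].

(** The modulus as a real number: the complex norm takes complex values, and
    estimates are better done in a totally ordered field. *)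
Definition cabs z : R := complex.Re `|z|.

Lemma cabsE z : (cabs z)%:C%C = `|z|.
Proof. by rewrite /cabs RRe_real// normr_real. Qed.

Lemma cabs_ge0 z : 0 <= cabs z.
Proof. by rewrite -ler0c cabsE normr_ge0. Qed.

Lemma cabs_le z (M : R) : (`|z| <= M%:C%C) = (cabs z <= M).
Proof. by rewrite -cabsE lecR. Qed.

Lemma cabsM z w : cabs (z * w) = cabs z * cabs w.
Proof. by apply: (@complexI R); rewrite rmorphM/= !cabsE normrM. Qed.

Lemma cabsD z w : cabs (z + w) <= cabs z + cabs w.
Proof. by rewrite -lecR rmorphD/= !cabsE ler_normD. Qed.

Lemma cabs_sum (I : finType) (F : I -> R[i]) :
  cabs (\sum_i F i) <= \sum_i cabs (F i).
Proof.
rewrite -lecR cabsE rmorph_sum/=; apply: le_trans (ler_norm_sum _ _ _) _.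
by apply: ler_sum => i _; rewrite cabsE.
Qed.

Lemma cabsN z : cabs (- z) = cabs z.
Proof. by rewrite /cabs normrN. Qed.

Lemma cabsB z w : cabs (z - w) = cabs (w - z).
Proof. by rewrite -cabsN opprB. Qed.

Lemma cabsJ z : cabs (z^*)%C = cabs z.
Proof. by rewrite /cabs normcJ. Qed.

Lemma cabs_nat (b : bool) : cabs b%:R = b%:R.
Proof. by rewrite /cabs normr_nat; case: b. Qed.

Lemma cabs_sqr z : cabs z ^+ 2 = complex.Re z ^+ 2 + complex.Im z ^+ 2.
Proof. by apply: (@complexI R); rewrite add_Re2_Im2 rmorphXn/= cabsE. Qed.

Lemma Re_le_cabs z : `|complex.Re z| <= cabs z.
Proof. by rewrite -lecR cabsE normc_ge_Re. Qed.

Lemma Im_le_cabs z : `|complex.Im z| <= cabs z.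
Proof.
rewrite -ler_sqr ?nnegrE ?cabs_ge0// real_normK ?num_real// cabs_sqr.
by rewrite lerDr sqr_ge0.
Qed.

Lemma cabs_le_ReIm z : cabs z <= `|complex.Re z| + `|complex.Im z|.
Proof.
rewrite -ler_sqr ?nnegrE ?cabs_ge0 ?addr_ge0// cabs_sqr sqrrD !real_normK ?num_real//.
by rewrite -addrA lerD2l lerDr mulrn_wge0// mulr_ge0.
Qed.

Lemma Re_mul_conj z : complex.Re (z * z^*)%C = cabs z ^+ 2.
Proof. by rewrite cabs_sqr; case: z => x y; rewrite /= mulrN opprK !expr2. Qed.

Lemma Re_mulNi z : complex.Re (- 'i%C * z) = complex.Im z.
Proof. by case: z => x y /=; ring. Qed.

End modulus.

Section bounded_functions.
Context (R : realType) (d : measure_display) (X : measurableType d).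
Context (mu : probability X R).
Implicit Types f g : X -> R[i].

Lemma LinftyP f : Linfty mu f <->
  [/\ measurable_fun setT (@complex.Re R \o f), measurable_fun setT (@complex.Im R \o f)
    & exists M : R, {ae mu, forall x, cabs (f x) <= M}].
Proof.
by split=> -[mr mi [M fM]]; split=> //; exists M; apply: filterS fM => x;
  rewrite cabs_le.
Qed.

Lemma LinftyD f g : Linfty mu f -> Linfty mu g -> Linfty mu (fun x => f x + g x).
Proof.
move=> /LinftyP[fr fi [M fM]] /LinftyP[gr gi [N gN]]; apply/LinftyP; split.
- rewrite (_ : _ \o _ = (@complex.Re R \o f) \+ (@complex.Re R \o g)).
    exact: measurable_funD.
  by apply/funext => x /=; case: (f x) (g x) => [? ?] [].
- rewrite (_ : _ \o _ = (@complex.Im R \o f) \+ (@complex.Im R \o g)).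
    exact: measurable_funD.
  by apply/funext => x /=; case: (f x) (g x) => [? ?] [].
- exists (M + N); apply: filterS2 fM gN => x fM gN.
  by rewrite (le_trans (cabsD _ _))// lerD.
Qed.

Lemma LinftyM f g : Linfty mu f -> Linfty mu g -> Linfty mu (fun x => f x * g x).
Proof.
move=> /LinftyP[fr fi [M fM]] /LinftyP[gr gi [N gN]]; apply/LinftyP; split.
- rewrite (_ : _ \o _ = ((@complex.Re R \o f) \* (@complex.Re R \o g)) \-
      ((@complex.Im R \o f) \* (@complex.Im R \o g))).
    by apply: measurable_funB; exact: measurable_funM.
  by apply/funext => x /=; case: (f x) (g x) => [? ?] [].
- rewrite (_ : _ \o _ = ((@complex.Re R \o f) \* (@complex.Im R \o g)) \+
      ((@complex.Im R \o f) \* (@complex.Re R \o g))).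
    by apply: measurable_funD; exact: measurable_funM.
  by apply/funext => x /=; case: (f x) (g x) => [? ?] [].
- exists (M * N); apply: filterS2 fM gN => x fM gN.
  by rewrite cabsM ler_pM ?cabs_ge0.
Qed.

Lemma Linfty_conj f : Linfty mu f -> Linfty mu (fun x => (f x)^*)%C.
Proof.
move=> /LinftyP[fr fi [M fM]]; apply/LinftyP; split.
- rewrite (_ : _ \o _ = @complex.Re R \o f)//.
  by apply/funext => x /=; case: (f x).
- rewrite (_ : _ \o _ = \- (@complex.Im R \o f)); first exact: measurableT_comp.
  by apply/funext => x /=; case: (f x).
- by exists M; apply: filterS fM => x; rewrite cabsJ.
Qed.

Lemma Linfty_cst (z : R[i]) : Linfty mu (fun=> z).
Proof.
apply/LinftyP; split; [exact: measurable_cst|exact: measurable_cst|].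
by exists (cabs z); apply: aeW.
Qed.

Lemma Linfty_finite (T : finType) (h : X -> T) (H : T -> R[i]) :
  (forall t, measurable (h @^-1` [set t])) -> Linfty mu (H \o h).
Proof.
move=> mh; apply/LinftyP; split.
- exact: (finite_measurable (@complex.Re R \o H) mh).
- exact: (finite_measurable (@complex.Im R \o H) mh).
- exists (\sum_t cabs (H t)); apply: aeW => x /=.
  by rewrite (bigD1 (h x))//= lerDl sumr_ge0// => t _; rewrite cabs_ge0.
Qed.

Lemma Linfty_nat (A : X -> bool) : measurable [set x | A x] ->
  Linfty mu (fun x => (A x)%:R).
Proof.
move=> mA; apply: (@Linfty_finite bool A (fun b => b%:R)) => -[].
  by rewrite (_ : _ @^-1` _ = [set x | A x])//; apply/seteqP; split=> x /=; case: (A x).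
rewrite (_ : _ @^-1` _ = ~` [set x | A x]); first exact: measurableC.
by apply/seteqP; split=> x /=; case: (A x).
Qed.

Lemma Linfty_Re_integrable f : Linfty mu f ->
  mu.-integrable setT (EFin \o (@complex.Re R \o f)).
Proof.
move=> /LinftyP[fr fi [M fM]]; apply: (ae_bounded_integrable (M := M)) => //.
by apply: filterS fM => x; exact: le_trans (Re_le_cabs _).
Qed.

(** The positive part of the difference has the same integral as the
    difference, and is nonnegative everywhere. *)
Lemma ae_le_Rintegral (f g : X -> R) :
  mu.-integrable setT (EFin \o f) -> mu.-integrable setT (EFin \o g) ->
  {ae mu, forall x, f x <= g x} -> \int[mu]_x f x <= \int[mu]_x g x.
Proof.
move=> fi gi fg; rewrite -subr_ge0 -RintegralB//.
rewrite /Rintegral fine_ge0//.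
have -> : (\int[mu]_x (g x - f x)%:E = \int[mu]_x (Num.max (g x - f x) 0)%:E)%E.
  apply: ae_eq_integral => //.
  - by have /integrableP[] := integrableB measurableT gi fi.
  - apply/measurable_EFinP; apply: measurable_maxr => //.
    by apply: measurable_funB; apply/measurable_EFinP;
      [have /integrableP[] := gi|have /integrableP[] := fi].
  - apply: filterS fg => x fgx _; congr EFin; apply/esym/max_idPl.
    by rewrite subr_ge0.
by apply: integral_ge0 => x _; rewrite lee_fin le_max lexx orbT.
Qed.

Lemma cst_integrable (e : R) : mu.-integrable setT (EFin \o (fun _ : X => e)).
Proof.
apply: (@ae_bounded_integrable _ _ _ _ _ `|e|); first exact: measurable_cst.
exact: aeW.
Qed.

Lemma Rintegral_dist_le (f g h : X -> R) :
  mu.-integrable setT (EFin \o f) -> mu.-integrable setT (EFin \o g) ->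
  mu.-integrable setT (EFin \o h) ->
  {ae mu, forall x, `|f x - g x| <= h x} ->
  `|\int[mu]_x f x - \int[mu]_x g x| <= \int[mu]_x h x.
Proof.
move=> fi gi hi fg; have mT : measurable [set: X] by [].
rewrite ler_norml; apply/andP; split.
  rewrite lerBrDr addrC lerBlDr -RintegralD//; apply: ae_le_Rintegral => //.
    exact: (integrableD mT fi hi).
  by apply: filterS fg => x; rewrite ler_norml => /andP[+ _]; lra.
rewrite lerBlDr addrC -RintegralD//; apply: ae_le_Rintegral => //.
  exact: (integrableD mT gi hi).
by apply: filterS fg => x; rewrite ler_norml => /andP[_]; lra.
Qed.

Lemma Rintegral_close (f g : X -> R) (e : R) :
  mu.-integrable setT (EFin \o f) -> mu.-integrable setT (EFin \o g) ->
  {ae mu, forall x, `|f x - g x| <= e} -> `|\int[mu]_x f x - \int[mu]_x g x| <= e.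
Proof.
move=> fi gi fg; rewrite -[leRHS]mulr1.
have <- : \int[mu]_x e = e * 1 by rewrite Rintegral_cst//= probability_setT.
exact: Rintegral_dist_le (cst_integrable e) fg.
Qed.

Lemma Rintegral_sum (I : finType) (F : I -> X -> R) :
  (forall i, mu.-integrable setT (EFin \o F i)) ->
  \int[mu]_x (\sum_i F i x) = \sum_i \int[mu]_x F i x.
Proof.
move=> iF; rewrite /Rintegral.
under eq_integral do rewrite -sumEFin.
rewrite integral_sum//.
rewrite (eq_bigr (fun i => (fine (\int[mu]_x (F i x)%:E))%:E)%E) => [|i _].
  by rewrite sumEFin.
by rewrite fineK//; exact: (integrable_fin_num measurableT (iF i)).
Qed.

Lemma integrable_Rsum (I : finType) (F : I -> X -> R) :
  (forall i, mu.-integrable setT (EFin \o F i)) ->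
  mu.-integrable setT (EFin \o (fun x => \sum_i F i x)).
Proof.
move=> iF; apply: (eq_integrable measurableT (fun x => \sum_i (F i x)%:E)%E).
  by move=> x _; rewrite /= sumEFin.
apply: (@integrable_sum _ _ _ mu setT measurableT I _ xpredT
  (fun i => EFin \o F i)) => i _.
exact: iF.
Qed.

End bounded_functions.

(** * Evaluation of terms *)

Section terms.
Context (R : realType) (G : groupType) (d : measure_display).
Context (X : measurableType d) (mu : probability X R).
Implicit Types (c : pmp_action G mu).

(** Preimages of null sets are null because the action preserves the measure. *)
Lemma ae_act c g (P : X -> Prop) :
  {ae mu, forall x, P x} -> {ae mu, forall x, P (c g x)}.
Proof.
move=> [N [mN N0 PN]]; exists (c g @^-1` N); split.
- exact: measurable_preimage (act_measurable c g) mN.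
- by rewrite act_preserving.
- by move=> x nPx; exact: PN.
Qed.

Lemma ae_finforall (I : finType) (P : I -> X -> Prop) :
  (forall i, {ae mu, forall x, P i x}) -> {ae mu, forall x, forall i, P i x}.
Proof. exact: filter_forall. Qed.

Section Linfty.
Hypothesis HX : standard_borel R X.

Lemma term_Linfty c n (v : 'I_n -> X -> R[i]) (t : term R G n) :
  (forall i, Linfty mu (v i)) -> Linfty mu (term_eval c v t).
Proof.
move=> vL; elim: t => [i||g|t IHt s IHs|t IHt s IHs|t IHt|z t IHt|g t IHt] /=.
- exact: vL.
- exact: Linfty_cst.
- apply: Linfty_nat; rewrite (_ : [set x | _] = [set x | c g x = x]).
    apply: standard_borel_eq_measurable HX (act_measurable c g) _.
    exact: measurable_id.
  by apply/seteqP; split=> x /eqP.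
- exact: LinftyD.
- exact: LinftyM.
- exact: Linfty_conj.
- exact: LinftyM (Linfty_cst _ _) _.
- have mc := act_measurable c g^-1%g.
  move/LinftyP: IHt => [tr ti [M tM]]; apply/LinftyP; split.
  + exact: measurableT_comp tr mc.
  + exact: measurableT_comp ti mc.
  + by exists M; exact: (ae_act c g^-1%g tM).
Qed.

Lemma term_inner_integrable c n (v : 'I_n -> X -> R[i]) (t s : term R G n) :
  (forall i, Linfty mu (v i)) -> mu.-integrable setT
  (EFin \o (fun x => complex.Re (term_eval c v t x * (term_eval c v s x)^*)%C)).
Proof.
move=> vL; apply: Linfty_Re_integrable; apply: LinftyM; first exact: term_Linfty.
by apply: Linfty_conj; exact: term_Linfty.
Qed.

End Linfty.

(** Multiplication is Lipschitz on bounded functions only.  Boundedness is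
    required on an invariant set because terms look at translates; the points
    whose whole orbit satisfies a bound that holds almost everywhere form a
    conull one. *)
Lemma term_lipschitz n (t : term R G n) (M : R) : 0 <= M -> exists2 K : R, 0 <= K &
  forall c (D : set X) (e : R) (v w : 'I_n -> X -> R[i]),
  (forall g x, D x -> D (c g x)) -> 0 <= e ->
  (forall x i, D x -> [/\ cabs (v i x) <= M, cabs (w i x) <= M &
    cabs (v i x - w i x) <= e]) ->
  forall x, D x -> [/\ cabs (term_eval c v t x) <= K,
    cabs (term_eval c w t x) <= K &
    cabs (term_eval c v t x - term_eval c w t x) <= K * e].
Proof.
move=> M0; have c0 : cabs (0 : R[i]) = 0 by have := cabs_nat R false.
elim: t => [i||g|t [K K0 IHt] s [L L0 IHs]|t [K K0 IHt] s [L L0 IHs]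
    |t [K K0 IHt]|z t [K K0 IHt]|g t [K K0 IHt]] /=.
- exists (M + 1) => [|c D e v w invD e0 vw x Dx]; first by lra.
  have [vM wM vwe] := vw x i Dx; split; [lra|lra|].
  by rewrite mulrDl mul1r (le_trans vwe)// lerDr mulr_ge0.
- exists 1 => // c D e v w invD e0 vw x Dx.
  by rewrite subrr c0 mul1r (cabs_nat R true).
- exists 1 => // c D e v w invD e0 vw x Dx.
  by rewrite subrr c0 mul1r cabs_nat lern1 leq_b1.
- exists (K + L) => [|c D e v w invD e0 vw x Dx]; first exact: addr_ge0.
  have [tv tw tvw] := IHt c D e v w invD e0 vw x Dx.
  have [sv sw svw] := IHs c D e v w invD e0 vw x Dx.
  split; [exact: le_trans (cabsD _ _) (lerD _ _)..|].
  rewrite opprD addrACA mulrDl; exact: le_trans (cabsD _ _) (lerD _ _).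
- exists (K * L + K * L) => [|c D e v w invD e0 vw x Dx].
    by rewrite addr_ge0 ?mulr_ge0.
  have [tv tw tvw] := IHt c D e v w invD e0 vw x Dx.
  have [sv sw svw] := IHs c D e v w invD e0 vw x Dx.
  have KL0 : 0 <= K * L by rewrite mulr_ge0.
  split.
  + by rewrite cabsM (le_trans (ler_pM _ _ tv sv)) ?cabs_ge0// lerDl.
  + by rewrite cabsM (le_trans (ler_pM _ _ tw sw)) ?cabs_ge0// lerDl.
  + set tV := term_eval c v t x in tv tvw *; set tW := term_eval c w t x in tw tvw *.
    set sV := term_eval c v s x in sv svw *; set sW := term_eval c w s x in sw svw *.
    rewrite (_ : _ - _ = tV * (sV - sW) + (tV - tW) * sW); last by ring.
    rewrite [leRHS]mulrDl (le_trans (cabsD _ _))// lerD// cabsM.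
      by rewrite -mulrA ler_pM ?cabs_ge0.
    by rewrite mulrAC ler_pM ?cabs_ge0.
- exists K => // c D e v w invD e0 vw x Dx.
  by rewrite -(rmorphB (@conjc R)) !cabsJ; exact: (IHt c D).
- exists (cabs z * K) => [|c D e v w invD e0 vw x Dx].
    by rewrite mulr_ge0 ?cabs_ge0.
  have [tv tw tvw] := IHt c D e v w invD e0 vw x Dx.
  by rewrite -mulrBr !cabsM -mulrA; split; rewrite ler_wpM2l ?cabs_ge0.
- exists K => // c D e v w invD e0 vw x Dx.
  exact: (IHt c D e v w invD e0 vw _ (invD _ _ Dx)).
Qed.

Section locality.
Variables (S : seq G) (HS : marking S).

(** The induction evaluates the term at [c g x] for an arbitrary [g], so that the
    action symbol only moves the base point. *)
Lemma local_map_term n (t : term R G n) (g : G) : local_map S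
  (fun c (s : X -> 'I_n -> R[i]) x => term_eval c (fun i y => s y i) t (c g x)).
Proof.
elim: t g => [i||h|t IHt s IHs|t IHt s IHs|t IHt|z t IHt|h t IHt] g /=.
- exact: (local_map_comp (fun u : 'I_n -> R[i] => u i) (local_map_label mu HS _ g)).
- exact: local_map_cst.
- apply: filterS (local_map_comp (fun b : bool => b%:R : R[i])
    (local_map_eq mu HS _ (h * g)%g g)) => r HE k pi.
  by have [H EH] := HE k pi; exists H => c f x; rewrite -EH actM.
- exact: (local_map_comp2 +%R (IHt g) (IHs g)).
- exact: (local_map_comp2 *%R (IHt g) (IHs g)).
- exact: (local_map_comp (@conjc R) (IHt g)).
- exact: (local_map_comp ( *%R z) (IHt g)).
- apply: filterS (IHt (h^-1 * g)%g) => r HE k pi.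
  by have [H EH] := HE k pi; exists H => c f x; rewrite -EH actM.
Qed.

Lemma local_map_inner n (t s : term R G n) : local_map S
  (fun c (l : X -> 'I_n -> R[i]) x =>
     complex.Re (term_eval c (fun i y => l y i) t x *
       (term_eval c (fun i y => l y i) s x)^*)%C).
Proof.
have := local_map_comp2 (fun z w => complex.Re (z * w^*)%C)
  (local_map_term t 1%g) (local_map_term s 1%g).
by apply: filterS => r HE k pi; have [H EH] := HE k pi; exists H => c f x;
  rewrite -EH !act1.
Qed.

End locality.
End terms.

(** * Local-global containment bounds the sentences *)

Section approximation.
Context (R : realType) (G : groupType) (d : measure_display).
Context (X : measurableType d) (mu : probability X R).
Implicit Types (a b c : pmp_action G mu).

Definition term_inner c n (v : 'I_n -> X -> R[i]) (t s : term R G n) : R :=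
  complex.Re (inner mu (term_eval c v t) (term_eval c v s)).

(** The quantifier-free content of weak containment, with no connective left: it
    is the pivot between sentences and local statistics. *)
Definition inner_approximable a b := forall n (v : 'I_n -> X -> R[i]),
  (forall i, Linfty mu (v i)) ->
  forall (I : finType) (t s : I -> term R G n) (e : R), 0 < e ->
  exists2 w : 'I_n -> X -> R[i], (forall i, Linfty mu (w i)) &
    forall i, `|term_inner a w (t i) (s i) - term_inner b v (t i) (s i)| < e.

(** A formula is a uniformly continuous function of finitely many real parts of
    inner products: the imaginary part of [<t, s>] is the real part of
    [<- i t, s>], and connectives are uniformly continuous. *)
Lemma qf_modulus n (psi : qf_formula R G n) (e : R) : 0 < e ->
  exists (I : finType) (t s : I -> term R G n), \forall dl \near 0^'+,
    forall a b v w,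
    (forall i, `|term_inner a w (t i) (s i) - term_inner b v (t i) (s i)| < dl) ->
    `|qf_eval a w psi - qf_eval b v psi| < e.
Proof.
elim: psi e => [t s|t s|m c uc F IH] e e0 /=.
- exists unit, (fun=> t), (fun=> s); near=> dl => a b v w /(_ tt) h.
  by apply: (lt_trans h); near: dl; exact: nbhs_right_lt.
- exists unit, (fun=> Scale (- 'i%C) t), (fun=> s); near=> dl => a b v w /(_ tt) h.
  apply: lt_trans (_ : dl < e); last by near: dl; exact: nbhs_right_lt.
  apply: le_lt_trans h; rewrite le_eqVlt; apply/orP; left; apply/eqP.
  congr (`|_ - _|); rewrite /term_inner /inner /complex_integral/=;
    by apply: eq_Rintegral => x _; rewrite -mulrA Re_mulNi.
- move/unif_continuousP : (uc) => /(_ _ e0)[d0 d00 hd].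
  have IH' i : exists p : {J : finType & ((J -> term R G n) * (J -> term R G n))%type},
      \forall dl \near 0^'+, forall a b v w,
      (forall j, `|term_inner a w ((tagged p).1 j) ((tagged p).2 j) -
         term_inner b v ((tagged p).1 j) ((tagged p).2 j)| < dl) ->
      `|qf_eval a w (F i) - qf_eval b v (F i)| < d0.
    by have [J [t [s h]]] := IH i d0 d00; exists (existT _ J (t, s)).
  have [H HE] := choice IH'.
  exists {i : 'I_m & tag (H i)}, (fun p => (tagged (H (tag p))).1 (tagged p)),
    (fun p => (tagged (H (tag p))).2 (tagged p)).
  apply: filterS (filter_forall _ HE) => dl {}HE a b v w h.
  rewrite -[ltLHS]normrN opprB.
  apply: (hd (\row_j qf_eval b v (F j), \row_j qf_eval a w (F j))).
  split=> // i j; rewrite !mxE /ball/= -[ltLHS]normrN opprB.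
  by apply: HE => p; exact: (h (existT _ j p)).
Unshelve. all: by end_near. Qed.

(** If [x + e < y], the first multiple of [e] above [x + M] gives a threshold that
    [y] passes and [x] does not. *)
Lemma threshold_separates (M e x y : R) N : 0 < e -> 2 * M < N%:R * e ->
  `|x| <= M -> `|y| <= M ->
  (forall j : 'I_N, (- M + j%:R * e <= x) = (- M + j%:R * e <= y)) -> y <= x + e.
Proof.
move=> e0 MN; rewrite !ler_norml => /andP[Mx xM] /andP[My yM] xy.
rewrite leNgt; apply/negP => xey.
have Mx0 : 0 <= (x + M) / e by apply: divr_ge0; lra.
have [tl tr] := andP (truncn_itv Mx0).
set j := (Num.trunc ((x + M) / e)).+1 in tr *.
have jx : x < - M + j%:R * e by move: tr; rewrite ltr_pdivrMr//; lra.
have jxe : - M + j%:R * e <= x + e.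
  have -> : j%:R = (Num.trunc ((x + M) / e))%:R + 1 :> R by rewrite natr1.
  move: tl; rewrite ler_pdivlMr//; set u := (Num.trunc _)%:R => tl.
  by rewrite (mulrDl u) mul1r; lra.
have jN : (j < N)%N.
  rewrite -(ltr_nat R) -(ltr_pM2r e0); lra.
have := xy (Ordinal jN); rewrite /= leNgt jx/= => /esym/negbT; rewrite -ltNge.
lra.
Qed.

(** The label records which of finitely many thresholds the real and imaginary
    parts pass, so points with the same label have close values; each label then
    takes the values of one of its points, which keeps the bound [M]. *)
Lemma finite_label_approx n (v : 'I_n -> X -> R[i]) (M e : R) : 0 < e ->
  (forall i, Linfty mu (v i)) ->
  exists k (f : X -> 'I_k) (pi : 'I_k -> 'I_n -> R[i]), label_measurable f /\
  forall x, (forall i, cabs (v i x) <= M) -> forall i,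
    cabs (pi (f x) i) <= M /\ cabs (v i x - pi (f x) i) <= e.
Proof.
move=> e0 vL; have e20 : 0 < e / 2 by rewrite divr_gt0.
pose part (p : 'I_n * bool) x :=
  if p.2 then complex.Re (v p.1 x) else complex.Im (v p.1 x).
have mpart p : measurable_fun setT (part p).
  by have /LinftyP[] := vL p.1; rewrite /part; case: p.2.
pose N := (Num.trunc (2 * M / (e / 2))).+1.
have MN : 2 * M < N%:R * (e / 2).
  rewrite -ltr_pdivrMr//; have [m0|m0] := leP 0 (2 * M / (e / 2)).
    by have /andP[] := truncn_itv m0.
  exact: lt_le_trans m0 _.
pose T := {ffun 'I_n * bool * 'I_N -> bool}.
pose h x : T := [ffun p : 'I_n * bool * 'I_N => - M + p.2%:R * (e / 2) <= part p.1 x].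
have mh : forall t, measurable (h @^-1` [set t]).
  apply: finfun_measurable => p.
  exact: (measurable_preimage (A := [set true])
    (measurable_fun_ler (measurable_cst _) (mpart p.1))).
pose f x := enum_rank (h x).
pose good x := forall i, cabs (v i x) <= M.
pose pi k := v^~ (get [set y | good y /\ f y = k]).
exists #|T|, f, pi; split.
  move=> k; rewrite (_ : _ @^-1` _ = h @^-1` [set enum_val k])//.
  apply/seteqP; split=> x /=; first by move=> <-; rewrite enum_rankK.
  by rewrite /f => ->; rewrite enum_valK.
move=> x gx i; have [] : good (get [set y | good y /\ f y = f x]) /\
    f (get [set y | good y /\ f y = f x]) = f x.
  by apply: (@getPex X [set y | good y /\ f y = f x]); exists x.
rewrite /pi; set y := get _ => gy /enum_rank_inj hyx; split; first exact: gy.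
have hE p j : (- M + (j : 'I_N)%:R * (e / 2) <= part p x) =
    (- M + j%:R * (e / 2) <= part p y).
  by have /ffunP/(_ (p, j)) := hyx; rewrite !ffunE.
have partM z (re : bool) : good z -> `|part (i, re) z| <= M.
  move=> /(_ i); apply: le_trans; case: re; [exact: Re_le_cabs|exact: Im_le_cabs].
have close (re : bool) : `|part (i, re) x - part (i, re) y| <= e / 2.
  rewrite ler_norml; apply/andP; split.
    have := threshold_separates e20 MN (partM x re gx) (partM y re gy) (hE _); lra.
  have := threshold_separates e20 MN (partM y re gy) (partM x re gx)
    (fun j => esym (hE _ j)); lra.
rewrite (le_trans (cabs_le_ReIm _))// (splitr e) lerD//.
  have := close true; rewrite /part/=; congr (`|_| <= _).
  by case: (v i x) (v i y) => ? ? [].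
have := close false; rewrite /part/=; congr (`|_| <= _).
by case: (v i x) (v i y) => ? ? [].
Qed.

Section marked.
Variables (S : seq G) (HS : marking S) (HX : standard_borel R X).

(** Replace the functions by step functions, which changes the inner products by
    at most [K * dl], and then transport the step functions to [a] through a
    labelling with close statistics. *)
Lemma local_global_inner_approximable a b :
  local_global_contains S a b -> inner_approximable a b.
Proof.
move=> ab n v vL I t s e e0.
have [M M0 vM] : exists2 M : R, 0 <= M & {ae mu, forall x g i, cabs (v i (b g x)) <= M}.
  have [m mv] : {m : 'I_n -> R & forall i, {ae mu, forall x, cabs (v i x) <= m i}}.
    by apply: (@choice 'I_n R (fun i M => {ae mu, forall x, cabs (v i x) <= M})) => i;
      have /LinftyP[_ _] := vL i.
  exists (\sum_i `|m i|); first by rewrite sumr_ge0.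
  have [u uG] := marking_countable HS.
  have h : {ae mu, forall x j i, cabs (v i (b (u j) x)) <= m i}.
    apply/ae_foralln => j; apply: ae_finforall => i.
    exact: (ae_act b (u j) (mv i)).
  apply: filterS h => x h g i; have [j <-] := uG g.
  apply: (le_trans (h j i)); apply: (le_trans (ler_norm _)).
  by rewrite (bigD1 i)//= lerDl sumr_ge0.
have [K K0 KP] : exists2 K : R, 0 <= K & forall i c (D : set X) (dl : R) v w,
    (forall g x, D x -> D (c g x)) -> 0 <= dl ->
    (forall x i, D x -> [/\ cabs (v i x) <= M, cabs (w i x) <= M &
      cabs (v i x - w i x) <= dl]) ->
    forall x, D x ->
    `|complex.Re (term_eval c v (t i) x * (term_eval c v (s i) x)^*)%C -
     complex.Re (term_eval c w (t i) x * (term_eval c w (s i) x)^*)%C| <= K * dl.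
  pose lip (i : I) (K : R) := 0 <= K /\
      forall c (D : set X) (dl : R) (v w : 'I_n -> X -> R[i]),
      (forall g x, D x -> D (c g x)) -> 0 <= dl ->
      (forall x i, D x -> [/\ cabs (v i x) <= M, cabs (w i x) <= M &
        cabs (v i x - w i x) <= dl]) ->
      forall x, D x -> cabs (term_eval c v (Mul (t i) (Star (s i))) x -
        term_eval c w (Mul (t i) (Star (s i))) x) <= K * dl.
  have [K KP] : {K : I -> R & forall i, lip i (K i)}.
    apply: choice => i.
    have [K K0 KP] := term_lipschitz mu (Mul (t i) (Star (s i))) M0.
    exists K; split=> // c D dl v' w' invD dl0 vw x Dx.
    by have [] := KP c D dl v' w' invD dl0 vw x Dx.
  exists (\sum_i K i) => [|i c D dl v' w' invD dl0 vw x Dx].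
    by rewrite sumr_ge0// => i _; have [] := KP i.
  apply: (@le_trans _ _ (K i * dl)); last first.
    rewrite ler_wpM2r// (bigD1 i)//= lerDl sumr_ge0// => j _.
    by have [] := KP j.
  have [_ /(_ c D dl v' w' invD dl0 vw x Dx)] := KP i.
  apply: le_trans; apply: le_trans (Re_le_cabs _).
  by rewrite /=; case: (_ * _)%R => ? ?; case: (_ * _)%R => ? ?.
(* Half of [e] is spent on the step functions, half on the statistics. *)
pose dl := e / (2 * (K + 1)).
have dl0 : 0 < dl by rewrite divr_gt0// mulr_gt0//; lra.
have [k [f [pi [mf fv]]]] := finite_label_approx M dl0 vL.
have Kdl : K * dl <= e / 2.
  have K1 : K + 1 != 0 by rewrite lt0r_neq0//; lra.
  rewrite (_ : K * dl = e / 2 * (K / (K + 1))); last by rewrite /dl; field.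
  apply: ler_piMr; first by apply: divr_ge0; lra.
  by rewrite ler_pdivrMr; lra.
(* The largest invariant set on which the bound holds. *)
pose D := [set x | forall g i, cabs (v i (b g x)) <= M].
have Dinv g x : D x -> D (b g x) by move=> Dx h i; rewrite -actM; exact: Dx.
have Dv x i : D x -> [/\ cabs (v i x) <= M, cabs (pi (f x) i) <= M &
    cabs (v i x - pi (f x) i) <= dl].
  move=> Dx; have vx j : cabs (v j x) <= M by have := Dx 1%g j; rewrite act1.
  by have [] := fv x vx i.
have Lpi (g : X -> 'I_k) : label_measurable g ->
    forall i, Linfty mu (fun x => pi (g x) i).
  by move=> mg i; apply: (Linfty_finite mu (pi^~ i)).
have near_b i : `|term_inner b (fun i x => pi (f x) i) (t i) (s i) -
    term_inner b v (t i) (s i)| <= e / 2.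
  apply: le_trans Kdl; rewrite -[leLHS]normrN opprB; apply: Rintegral_close.
  - exact: term_inner_integrable.
  - by apply: term_inner_integrable => //; exact: Lpi.
  - apply: filterS vM => x vMx; exact: (KP i b D dl _ _ Dinv (ltW dl0) Dv).
have e20 : 0 < e / 2 by rewrite divr_gt0.
have := filter_forall _ (fun i : I =>
  local_map_integral HX a b (local_map_inner mu HS (t i) (s i))).
case=> r _ /(_ r (leqnn r)) Hr.
have Hn := filter_forall (at_right_proper_filter (0 : R))
  (fun i : I => Hr i k pi _ e20).
case: (@filter_ex _ _ (at_right_proper_filter (0 : R)) _
  (filterI Hn (nbhs_right_gt 0))) => dl' [{}Hn dl'0].
have [f' mf' ff'] := local_global_approx ab r mf dl'0.
exists (fun i x => pi (f' x) i) => [|i]; first exact: Lpi.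
rewrite (splitr e) (le_lt_trans (ler_distD
  (term_inner b (fun i x => pi (f x) i) (t i) (s i)) _ _))// ltr_leD//.
rewrite -[ltLHS]normrN opprB.
exact: Hn mf mf' ff'.
Qed.

End marked.

Lemma inner_approximable_sigma1 a b : standard_borel R X ->
  inner_approximable a b ->
  forall phi : sigma1_sentence R G, sigma1_value a phi <= sigma1_value b phi.
Proof.
move=> HX ab [n psi [m psim]]; rewrite /sigma1_value /=.
apply: lb_le_inf.
  exists (qf_eval b (fun i x => 0) psi); exists (fun i x => 0) => //.
  by move=> i; exact: Linfty_cst.
move=> _ [v vL <-]; apply/ler_addgt0Pr => e e0.
have [I [t [s h]]] := qf_modulus psi e0.
case: (@filter_ex _ _ (at_right_proper_filter (0 : R)) _
  (filterI h (nbhs_right_gt 0))) => dl [{}h dl0].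
have [w wL wv] := ab n v vL I t s dl dl0.
apply: (@le_trans _ _ (qf_eval a w psi)).
  apply: ge_inf; last by exists w.
  by exists m => _ [u uL <-]; exact: psim.
rewrite -lerBlDl; apply: le_trans (ler_norm _) (ltW _).
exact: h.
Qed.

End approximation.

(** * The sentences determine the local statistics *)

Section distance_sentence.
Context (R : realType) (G : groupType) (d : measure_display).
Context (X : measurableType d) (mu : probability X R).
Implicit Types (a b : pmp_action G mu).

Lemma l1_dist_unif_continuous m (u0 : 'rV[R]_m) :
  unif_continuous (fun u : 'rV[R]_m => \sum_j `|u 0 j - u0 0 j|).
Proof.
apply/unif_continuousP => e e0.
have m0 : 0 < m%:R + 1 :> R by rewrite ltr_wpDl.
exists (e / (m%:R + 1)); first by rewrite divr_gt0.
move=> [u v] /= [_ uv]; rewrite /ball/= -sumrB.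
apply: (@le_lt_trans _ _ (\sum_(j < m) e / (m%:R + 1))).
  apply: le_trans (ler_norm_sum _ _ _) _; apply: ler_sum => j _.
  apply: le_trans (ler_dist_dist _ _) _.
  rewrite (_ : _ - _ = u 0 j - v 0 j); last by ring.
  by have := uv 0 j; rewrite /ball/= => /ltW.
rewrite sumr_const card_ord -[X in X < _]mulr_natl mulrA ltr_pdivrMr//.
by rewrite mulrC ltr_pM2l// ltrDl.
Qed.

(** The distance to the values in [b] of finitely many inner products is a
    nonnegative sentence that vanishes in [b]. *)
Lemma sigma1_inner_approximable a b : standard_borel R X ->
  (forall phi : sigma1_sentence R G, sigma1_value a phi <= sigma1_value b phi) ->
  inner_approximable a b.
Proof.
move=> HX ab n v vL I t s e e0.
pose u0 : 'rV[R]_#|I| := \row_j term_inner b v (t (enum_val j)) (s (enum_val j)).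
pose psi : qf_formula R G n := Connective (l1_dist_unif_continuous u0)
  (fun j => ReInner (t (enum_val j)) (s (enum_val j))).
have psi_ge0 : qf_bounded_below psi.
  by exists 0 => d' Y nu c w _ _ /=; rewrite sumr_ge0.
have aE (c : pmp_action G mu) w : qf_eval c w psi =
    \sum_(j < #|I|) `|term_inner c w (t (enum_val j)) (s (enum_val j)) -
      term_inner b v (t (enum_val j)) (s (enum_val j))|.
  by rewrite /psi/=; apply: eq_bigr => j _; rewrite !mxE.
have b0 : sigma1_value b (Sigma1 psi_ge0) <= 0.
  apply: ge_inf.
    by exists 0 => _ [w wL <-]; rewrite aE sumr_ge0.
  by exists v => //; rewrite aE big1// => j _; rewrite subrr normr0.
have : sigma1_value a (Sigma1 psi_ge0) < e.
  exact: le_lt_trans (ab _) (le_lt_trans b0 e0).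
move=> /inf_lt[|_ [w wL <-]].
  exists (qf_eval a v psi); exists v => //.
rewrite aE => we; exists w => // i; apply: le_lt_trans we.
by rewrite (bigD1 (enum_rank i))//= enum_rankK lerDl sumr_ge0.
Qed.

End distance_sentence.

Section near_idempotents.
Context (R : realType).
Implicit Types z : R[i].

Lemma idempotent_defect z : cabs (z * z - z) = cabs z * cabs (z - 1).
Proof. by rewrite -cabsM; congr cabs; ring. Qed.

(** The squared modulus is the real part of a product, so that this condition on
    a bounded measurable function defines a measurable set. *)
Definition near1 z : bool := cabs (z - 1) ^+ 2 < 16^-1.

Lemma near1E z : near1 z = (cabs (z - 1) < 4^-1).
Proof.
rewrite /near1 (_ : 16^-1 = (4^-1) ^+ 2 :> R); last by rewrite exprVn -natrX.
by rewrite ltr_sqr ?nnegrE ?cabs_ge0// invr_ge0.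
Qed.

Lemma cabs_1 : cabs (1 : R[i]) = 1.
Proof. exact: cabs_nat true. Qed.

Lemma near1_large z : near1 z -> 3 / 4 < cabs z.
Proof.
rewrite near1E => z1; have := cabsD (1 - z) z; rewrite subrK cabs_1 cabsB; lra.
Qed.

Lemma near1_defect z : near1 z -> cabs (z - 1) <= 4 * cabs (z * z - z).
Proof.
move=> /near1_large z1; rewrite idempotent_defect.
have := cabs_ge0 (z - 1); nra.
Qed.

Lemma not_near1_defect z : ~~ near1 z -> cabs z <= 4 * cabs (z * z - z).
Proof.
rewrite near1E -leNgt => z1; rewrite idempotent_defect.
have := cabs_ge0 z; nra.
Qed.

(** Large values of [z] are dominated by the defect [z * z - z], which stands in for
    a bound on [z]. *)
Lemma cabs_le_defect z : cabs z <= cabs (z * z - z) + 2.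
Proof.
have := cabsD (z - 1) 1; rewrite subrK cabs_1 idempotent_defect.
have [z2|z2] := leP (cabs z) 2.
  by have := cabs_ge0 z; have := cabs_ge0 (z - 1); nra.
nra.
Qed.

(** Sentences control squares of defects, in the mean; this trades them for the
    defects themselves. *)
Lemma le_sqr_amgm (x eta : R) : 0 <= x -> 0 < eta -> x <= eta + eta^-1 * x ^+ 2.
Proof.
move=> x0 eta0; have ei : 0 < eta^-1 by rewrite invr_gt0.
have [xe|ex] := leP x eta; first by rewrite (le_trans xe)// lerDl mulr_ge0 ?sqr_ge0// ltW.
apply: (@le_trans _ _ (eta^-1 * x ^+ 2)); last by rewrite lerDr ltW.
by rewrite expr2 mulrA ler_peMl// mulrC ler_pdivlMr// mul1r ltW.
Qed.

End near_idempotents.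

Section decoding.
Context (R : realType) (G : groupType) (S : seq G) (d : measure_display).
Context (X : measurableType d) (mu : probability X R) (r k : nat).
Implicit Types (c : pmp_action G mu).
Local Notation B := (ballT S r).
Local Notation W := (labelled_qball S r k).

Lemma ball_one : 1%g \in cayley_ball S r.
Proof. by apply: (cayley_ball_mono (leq0n r)); rewrite mem_head. Qed.

Let one : B := SeqSub ball_one.

Definition ball_label (w : W) (g : B) : 'I_k := tagged w (qproj (tag w) g).

Local Notation eqn := ((W + unit) + (W * B * W + W * B * B))%type.
Local Notation T := (term R G #|W|).
Local Notation z := (fun w : W => Var R G (enum_rank w)).

(** One variable [z w] for the indicator of each pattern [w].  The equations say
    that the [z w] are idempotent and sum to one, that the label which the
    pattern at a point gives to [g] is the label that the pattern at the
    translate by [g] gives to the identity, and that the pattern describes the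
    coincidences in the ball.  The constant zero stands for the pairs of patterns
    on which the third equation imposes nothing. *)
Definition equation (i : eqn) : T :=
  match i with
  | inl (inl w) => Add (Mul (z w) (z w)) (Scale (-1) (z w))
  | inl (inr _) => foldr (fun w t => Add (z w) t) (Scale (-1) (One R G _)) (enum W)
  | inr (inl (w, g, w')) => if ball_label w g != ball_label w' one
      then Mul (z w) (Act (val g)^-1%g (z w')) else Scale 0 (One R G _)
  | inr (inr (w, g, h)) => if (g, h) \in val (tag w)
      then Mul (z w) (Add (One R G _) (Scale (-1) (Fix R _ ((val h)^-1 * val g)%g)))
      else Mul (z w) (Fix R _ ((val h)^-1 * val g)%g)
  end.

(** The equations at the translate of the point by an element of the ball: the
    pattern at [x] involves labels of all these translates. *)
Definition moved_equation (p : B * eqn) : T := Act (val p.1)^-1%g (equation p.2).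

Lemma moved_equationE c v p x :
  term_eval c v (moved_equation p) x = term_eval c v (equation p.2) (c (val p.1) x).
Proof. by rewrite /= invgK. Qed.

Lemma sum_equationE c v x : term_eval c v (equation (inl (inr tt))) x =
  \sum_w v (enum_rank w) x - 1.
Proof.
rewrite /= -big_enum/=; elim: (enum W) => [|w s IH] /=.
  by rewrite big_nil mulr1 sub0r.
by rewrite big_cons IH addrA.
Qed.

Lemma fix_equationE c (g h : B) x :
  (c ((val h)^-1 * val g)%g x == x) = (c (val g) x == c (val h) x).
Proof.
rewrite actM; apply/eqP/eqP => [/(congr1 (c (val h)))|->].
  by rewrite -actM mulgV act1.
by rewrite -actM mulVg act1.
Qed.

Lemma equation_pattern c (f : X -> 'I_k) i x :
  term_eval c (fun j y => (pattern S c f r y == enum_val j)%:R) (equation i) x = 0.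
Proof.
case: i => [[w|[]]|[[[w g] w']|[[w g] h]]].
- by rewrite /= enum_rankK; case: eqP => _; rewrite ?mulr0 ?addr0// !mulr1 subrr.
- rewrite sum_equationE (bigD1 (pattern S c f r x))//= enum_rankK eqxx.
  rewrite big1 ?addr0 ?subrr// => w wx; rewrite enum_rankK.
  by rewrite eq_sym (negbTE wx).
- rewrite /=; case: ifPn => [wg|_] /=; last by rewrite mul0r.
  rewrite !enum_rankK invgK; case: eqP => [wx|]; last by rewrite mul0r.
  case: eqP => [wx'|]; last by rewrite mulr0.
  move: wg; rewrite /ball_label -wx -wx' !pattern_label /= act1 eqxx//.
- rewrite /=; case: ifPn => gh /=; rewrite enum_rankK fix_equationE;
    case: eqP => [wx|]; rewrite ?mul0r// mul1r.
    by move: gh; rewrite -wx pattern_tag => ->; rewrite mulN1r subrr.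
  by move: gh; rewrite -wx pattern_tag => /negbTE ->.
Qed.

Section decode.
Variables (c : pmp_action G mu) (v : 'I_#|W| -> X -> R[i]) (f0 : X -> 'I_k).

(** The label of [y] is read off any pattern whose variable is close to one at
    [y]; elsewhere it is a constant. *)
Definition decode (y : X) : 'I_k :=
  if [pick w : W | near1 (v (enum_rank w) y)] is Some w then ball_label w one
  else f0 point.

(** With all defects below this threshold, variables that are not close to one
    contribute at most [1 / 4] to the sum of all variables, which is then too far
    from one unless some variable is close to one. *)
Definition threshold : R := (16 * (#|W|%:R + 1))^-1.

Lemma threshold_gt0 : 0 < threshold.
Proof. by rewrite invr_gt0 mulr_gt0// ltr_wpDl. Qed.

Lemma threshold_le : threshold <= 16^-1.
Proof.
by rewrite lef_pV2 ?posrE// ?mulr_gt0 ?ltr_wpDl// ler_peMr// lerDr.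
Qed.

Lemma exists_near1 y :
  (forall i, cabs (term_eval c v (equation i) y) < threshold) ->
  exists w : W, near1 (v (enum_rank w) y).
Proof.
move=> small; apply: contrapT => /forallNP none.
have := small (inl (inr tt)); rewrite sum_equationE.
set s := \sum_w _ => s1.
have s4 : cabs s <= 4^-1.
  have : cabs s <= \sum_(w : W) 4 * threshold.
    apply: le_trans (cabs_sum _) _; apply: ler_sum => w _.
    have nw : ~~ near1 (v (enum_rank w) y) by apply/negP; exact: none.
    apply: le_trans (not_near1_defect nw) _.
    rewrite ler_pM2l//; apply: le_trans (ltW (small (inl (inl w)))).
    by rewrite /= mulN1r.
  move=> /le_trans; apply.
  have -> : \sum_(w : W) 4 * threshold = #|W|%:R * (4 * threshold).
    by rewrite sumr_const [RHS]mulr_natl.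
  rewrite /threshold; have : 0 <= #|W|%:R :> R by [].
  move: (#|W|%:R : R) => N N0.
  rewrite (_ : N * _ = 4^-1 * (N / (N + 1))); last by field; lra.
  by rewrite ler_piMr// ler_pdivrMr; lra.
have := cabsD s (1 - s); rewrite addrCA subrr addr0 cabs_1 (cabsB 1).
have := threshold_le; lra.
Qed.

(** A variable close to one cannot be multiplied by something close to one with
    a small result, so a pattern [w] that disagrees with what is seen at [x] would
    violate an equation noticeably.
    The labels at the translates are decoded from their own patterns, which must
    agree with [w] for the same reason. *)
Lemma near1_pattern x (w : W) :
  (forall p, cabs (term_eval c v (moved_equation p) x) < threshold) ->
  near1 (v (enum_rank w) x) -> pattern S c decode r x = w.
Proof.
move=> small wx; have wl := near1_large wx; have t16 := threshold_le.
have small1 i : cabs (term_eval c v (equation i) x) < threshold.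
  by have := small (one, i); rewrite moved_equationE /= act1.
apply/patternP; split.
  apply/val_inj/setP => -[g h]; rewrite inE/=.
  have := small1 (inr (inr (w, g, h))); rewrite /=; case: ifPn => gh /=;
    rewrite fix_equationE cabsM; case: eqP => // _; rewrite ?mulr0 ?addr0 cabs_1; lra.
move=> g; rewrite /decode; case: pickP => [w' w'g|none]; last first.
  have [i|w' w'g] := @exists_near1 (c (val g) x).
    by have := small (g, i); rewrite moved_equationE.
  by have := none w'; rewrite w'g.
apply/esym/eqP/negPn/negP => ww'; have w'l := near1_large w'g.
have := small1 (inr (inl (w, g, w'))); rewrite /= ifT//= invgK cabsM; nra.
Qed.

(** Where all defects are below the threshold, [z] is within four times its own
    defect of the indicator of the decoded pattern; the remaining points are paid
    for by the squared defects, one of which exceeds the squared threshold. *)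
Lemma decode_defect x (w : W) (eta : R) : 0 < eta ->
  cabs (v (enum_rank w) x - (pattern S c decode r x == w)%:R) <=
  4 * eta + (3 * threshold ^- 2 + 4 / eta) *
    \sum_p cabs (term_eval c v (moved_equation p) x) ^+ 2.
Proof.
move=> eta0; set zw := v _ _; set s := \sum_p _.
have t0 := threshold_gt0.
have sp p : cabs (term_eval c v (moved_equation p) x) ^+ 2 <= s.
  by rewrite /s (bigD1 p)//= lerDl sumr_ge0// => q _; rewrite sqr_ge0.
have s0 : 0 <= s by rewrite sumr_ge0// => q _; rewrite sqr_ge0.
have D1 : cabs (zw * zw - zw) <= eta + eta^-1 * s.
  apply: le_trans (le_sqr_amgm (cabs_ge0 _) eta0) _.
  rewrite lerD2l; apply: ler_wpM2l; first by rewrite invr_ge0 ltW.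
  apply: le_trans (sp (one, inl (inl w))).
  by rewrite moved_equationE /= act1 mulN1r.
have D4 : 4 * cabs (zw * zw - zw) <= 4 * eta + 4 / eta * s.
  by rewrite -mulrA -mulrDr ler_wpM2l.
have T0 : 0 <= 3 * threshold ^- 2 by rewrite mulr_ge0// invr_ge0 sqr_ge0.
rewrite [X in _ <= _ + X]mulrDl addrCA.
have [small|/existsNP[p /negP]] := pselect
    (forall p, cabs (term_eval c v (moved_equation p) x) < threshold).
  apply: (@le_trans _ _ (4 * cabs (zw * zw - zw))); last first.
    by apply: le_trans D4 _; rewrite lerDr mulr_ge0.
  have [wn|wn] := boolP (near1 zw).
    by rewrite (near1_pattern small wn) eqxx; exact: near1_defect.
  rewrite (_ : _ == w = false) ?subr0; first exact: not_near1_defect.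
  apply/eqP => xw.
  have [i|w' w'x] := @exists_near1 x.
    by have := small (one, i); rewrite moved_equationE /= act1.
  by move: wn; rewrite /zw -xw (near1_pattern small w'x) w'x.
rewrite -leNgt => big.
have b3 : 3 <= 3 * threshold ^- 2 * s.
  rewrite -mulrA ler_peMr// mulrC ler_pdivlMr ?exprn_gt0// mul1r.
  by apply: le_trans (sp p); rewrite ler_sqr ?nnegrE ?cabs_ge0 ?(ltW t0).
have z1 := cabs_le_defect zw.
apply: le_trans (cabsD _ _) _; rewrite cabsN cabs_nat.
have : (pattern S c decode r x == w)%:R <= 1 :> R by rewrite lern1 leq_b1.
have := cabs_ge0 (zw * zw - zw); lra.
Qed.

Lemma decode_measurable : (forall i, Linfty mu (v i)) -> label_measurable decode.
Proof.
move=> vL i; pose h x : {ffun W -> bool} := [ffun w => near1 (v (enum_rank w) x)].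
pose F (t : {ffun W -> bool}) :=
  if [pick w | t w] is Some w then ball_label w one else f0 point.
rewrite (_ : decode @^-1` _ = h @^-1` (F @^-1` [set i])).
  apply: finite_preimage_measurable; apply: finfun_measurable => w.
  have LB : Linfty mu (fun x => v (enum_rank w) x - 1).
    exact: LinftyD (vL _) (Linfty_cst _ _).
  have /LinftyP[mr _ _] := LinftyM LB (Linfty_conj LB).
  apply: (measurable_preimage (A := [set true])
    (measurable_fun_ltr _ (measurable_cst _))) => //.
  by move: mr; congr measurable_fun; apply/funext => x /=; rewrite Re_mul_conj.
have FE x : F (h x) = decode x.
  rewrite /F /decode; have -> : (fun w => h x w) = (fun w => near1 (v (enum_rank w) x)).
    by apply/funext => w; rewrite ffunE.
  by [].
by apply/seteqP; split=> x; rewrite /= FE.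
Qed.

End decode.
End decoding.

Section decoded_statistics.
Context (R : realType) (G : groupType) (S : seq G) (d : measure_display).
Context (X : measurableType d) (mu : probability X R).
Hypothesis HX : standard_borel R X.

Lemma local_stat_Rintegral (c : pmp_action G mu) r k (f : X -> 'I_k)
    (w : labelled_qball S r k) : label_measurable f ->
  local_stat c f w = \int[mu]_x (pattern S c f r x == w)%:R.
Proof.
move=> mf; rewrite local_statE -pr_Rintegral; last exact: pattern_measurable.
apply: eq_Rintegral => x _; rewrite indicE; congr (nat_of_bool _)%:R.
by apply/idP/eqP => [/set_mem|?]//; exact: mem_set.
Qed.

Lemma pattern_eq_Linfty (c : pmp_action G mu) r k (f : X -> 'I_k)
    (w : labelled_qball S r k) : label_measurable f ->
  Linfty mu (fun x => (pattern S c f r x == w)%:R).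
Proof.
move=> mf; apply: Linfty_nat.
rewrite (_ : [set x | _] = pattern S c f r @^-1` [set w]).
  exact: pattern_measurable.
by apply/seteqP; split=> x /= => [/eqP|->].
Qed.

Lemma Re_nat_mul1 (p : bool) : complex.Re (p%:R * (1 : R[i])^*)%C = p%:R.
Proof. by case: p; rewrite ?mul0r// mul1r. Qed.

Lemma Re_mul1 (u : R[i]) : complex.Re (u * (1 : R[i])^*)%C = complex.Re u.
Proof. by case: u => x y /=; ring. Qed.

(** All squared defects and all integrals of the variables are inner products of
    terms, so they can be made close to their values for the indicators of the
    patterns in [b], which are zero and the local statistics of [b]. *)
Lemma inner_approximable_local_global (a b : pmp_action G mu) :
  inner_approximable a b -> local_global_contains S a b.
Proof.
move=> ab; apply: local_global_intro => r k f e mf e0.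
pose W : finType := labelled_qball S r k; pose N : R := #|W|%:R.
have N0 : 0 <= N by rewrite /N.
pose E : finType := (ballT S r *
  ((W + unit) + (W * ballT S r * W + W * ballT S r * ballT S r)))%type.
pose D : E -> term R G #|W| := @moved_equation R G S r k.
pose v (i : 'I_#|W|) x : R[i] := (pattern S b f r x == enum_val i)%:R.
have vL i : Linfty mu (v i) by exact: pattern_eq_Linfty.
(* Each of the [N] statistics is off by at most [4 * eta] from the pointwise
   estimate and [eta] from the inner products, which are within [dl]. *)
pose eta := e / (5 * (N + 1)).
have eta0 : 0 < eta by rewrite divr_gt0// mulr_gt0//; lra.
pose C := 3 * @threshold R G S r k ^- 2 + 4 / eta.
have C0 : 0 <= C.
  by rewrite addr_ge0 ?mulr_ge0 ?invr_ge0 ?sqr_ge0 ?(ltW eta0).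
pose M : R := #|E|%:R; have M0 : 0 <= M by rewrite /M.
pose dl := eta / (1 + C * M).
have CM1 : 0 < 1 + C * M by rewrite ltr_wpDr// mulr_ge0.
have dl0 : 0 < dl by rewrite divr_gt0.
pose t (i : E + W) := match i with inl p => D p | inr w => Var R G (enum_rank w) end.
pose s (i : E + W) := match i with inl p => D p | inr w => One R G #|W| end.
have [v' v'L v'v] := ab _ v vL _ t s dl dl0.
pose f' := decode v' f.
have mf' : label_measurable f' by exact: decode_measurable.
exists f' => //; apply: tv_le_sum => //.
have DI p : term_inner a v' (D p) (D p) <= dl.
  have := v'v (inl p); rewrite /= [term_inner b _ _ _](_ : _ = 0).
    by rewrite subr0 => /ltW; apply: le_trans; exact: ler_norm.
  rewrite -[RHS](mul0r (fine (mu setT))) -Rintegral_cst//.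
  apply: eq_Rintegral => x _.
  by rewrite /D moved_equationE equation_pattern mul0r.
have cabsI p : mu.-integrable setT
    (EFin \o (fun x => cabs (term_eval a v' (D p) x) ^+ 2)).
  apply: (eq_integrable measurableT _ _ _ (term_inner_integrable HX a (D p) (D p) v'L)).
  by move=> x _; congr EFin; rewrite -Re_mul_conj.
have close (w : W) : `|local_stat b f w - local_stat a f' w| <= 5 * eta.
  have aw : `|\int[mu]_x complex.Re (v' (enum_rank w) x) - local_stat a f' w| <=
      4 * eta + C * (M * dl).
    rewrite local_stat_Rintegral//.
    have sI := integrable_Rsum cabsI.
    have CI : mu.-integrable setT (EFin \o (fun x => C *
        \sum_p cabs (term_eval a v' (D p) x) ^+ 2)).
      exact: (integrableZl measurableT C sI).
    have hI := integrableD measurableT (cst_integrable mu (4 * eta)) CI.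
    have pI : mu.-integrable setT (EFin \o (fun x => (pattern S a f' r x == w)%:R : R)).
      apply: (eq_integrable measurableT _ _ _
        (Linfty_Re_integrable (pattern_eq_Linfty a w mf'))).
      by move=> x _ /=; case: eqP.
    apply: le_trans (Rintegral_dist_le (Linfty_Re_integrable (v'L _)) pI hI _) _.
      apply: aeW => x; apply: le_trans (decode_defect a v' f x w eta0).
      apply: le_trans (Re_le_cabs _).
      rewrite -/f' /=; case: (v' _ x) => p q.
      by case: (_ == w); rewrite /= ?oppr0 lexx.
    rewrite (RintegralD measurableT (cst_integrable mu (4 * eta)) CI).
    rewrite Rintegral_cst//= probability_setT mulr1 lerD2l (RintegralZl _ measurableT sI).
    apply: ler_wpM2l => //; rewrite Rintegral_sum//.
    rewrite [leRHS](_ : _ = \sum_(p : E) dl); last by rewrite sumr_const [LHS]mulr_natl.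
    apply: ler_sum => p _; apply: le_trans (DI p).
    by rewrite le_eqVlt; apply/orP; left; apply/eqP; apply: eq_Rintegral => x _;
      rewrite Re_mul_conj.
  have bw : `|\int[mu]_x complex.Re (v' (enum_rank w) x) - local_stat b f w| <= dl.
    have := v'v (inr w) => /ltW; apply: le_trans.
    rewrite local_stat_Rintegral// le_eqVlt; apply/orP; left; apply/eqP.
    congr (`|_ - _|); apply: eq_Rintegral => x _ /=; first by rewrite Re_mul1.
    by rewrite /v enum_rankK Re_nat_mul1.
  apply: le_trans (ler_distD (\int[mu]_x complex.Re (v' (enum_rank w) x)) _ _) _.
  apply: le_trans (lerD _ aw) _; first by rewrite distrC; exact: bw.
  have -> : dl + (4 * eta + C * (M * dl)) = 4 * eta + dl * (1 + C * M) by ring.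
  by rewrite /dl divfK ?lt0r_neq0//; lra.
apply: (@le_lt_trans _ _ (\sum_(w : W) 5 * eta)); first exact: ler_sum.
have -> : \sum_(w : W) 5 * eta = N * (5 * eta) by rewrite sumr_const [RHS]mulr_natl.
have N1 : 0 < N + 1 by lra.
rewrite (_ : N * _ = e * (N / (N + 1))); last by rewrite /eta; field; lra.
by rewrite gtr_pMr// ltr_pdivrMr//; lra.
Qed.

End decoded_statistics.

(** * Measure and action on the ultrapower *)

Lemma measure_bigsetU_le d (T : measurableType d) (R : realType)
    (m : {measure set T -> \bar R}) (I : Type) (s : seq I) (E : I -> set T) :
  (forall i, measurable (E i)) ->
  (m (\big[setU/set0]_(i <- s) E i) <= \sum_(i <- s) m (E i))%E.
Proof.
move=> mE; elim: s => [|i s IH]; first by rewrite !big_nil measure0.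
rewrite !big_cons.
apply: (@le_trans _ _ (m (E i) + m (\big[setU/set0]_(j <- s) E j))%E).
  by apply: measureU2 => //; exact: bigsetU_measurable.
exact: leeD2l.
Qed.

Section ultrapower_facts.
Context (R : realType) (G : groupType) (d : measure_display).
Context (X : measurableType d) (mu : probability X R).
Context (U : nonprincipal_ultrafilter).
Local Notation XU := (ultra_measurableType mu U).
Local Notation muU := (ultra_measure mu U).
Local Notation content := (@internal_content R d X mu U).

Lemma ultra_cvg (A : nat -> set X) : (forall i, measurable (A i)) ->
  mu (A i) @[i --> uf_sets U] --> muU (internal U A).
Proof.
by move=> mA; rewrite ultra_measureE// -internal_contentE//; exact: internal_content_cvg.
Qed.

Lemma internalT : internal U (fun=> setT) = setT :> set (ultrapower X U).
Proof.
rewrite -[RHS]setC0 -(internal0 X U) -internalC; congr internal.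
by apply/funext => i; rewrite setC0.
Qed.

Lemma ultra_measureT : muU setT = 1%E.
Proof.
rewrite -internalT; have := ultra_cvg (fun=> @measurableT _ X).
move=> /(@cvg_lim _ (@ereal_hausdorff R)) <-.
by rewrite probability_setT lim_cst//; exact: ereal_hausdorff.
Qed.

Lemma ultra_measure_fin (E : set XU) : measurable E -> muU E \is a fin_num.
Proof.
move=> mE; rewrite ge0_fin_numE// (@le_lt_trans _ _ 1%E)// ?ltry//.
by rewrite -ultra_measureT; apply: le_measure; rewrite ?inE.
Qed.

Lemma ultra_pr_cvg (A : nat -> set X) : (forall i, measurable (A i)) ->
  fine (mu (A i)) @[i --> uf_sets U] --> fine (muU (internal U A)).
Proof.
move=> mA; apply: fine_cvg; rewrite fineK; first exact: ultra_cvg.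
exact/ultra_measure_fin/internal_ultra_measurable.
Qed.

Lemma ultra_measure_internal (A : nat -> set X) : (forall i, measurable (A i)) ->
  muU (internal U A) = content (internal U A).
Proof. by move=> mA; rewrite ultra_measureE// internal_contentE. Qed.

(** The predicates live on the measurable type of the ultrapower, which unfolds to
    [ultrapower X U]; fixing this type lets unification find the measure. *)
Lemma ultra_ae2 (P Q T : XU -> Prop) : (forall q, P q -> Q q -> T q) ->
  {ae muU, forall q, P q} -> {ae muU, forall q, Q q} -> {ae muU, forall q, T q}.
Proof.
move=> PQT aP aQ.
have aF : Filter (almost_everywhere muU) by apply: ae_filter_ringOfSetsType.
exact: (@filterS2 _ _ aF _ _ _ PQT aP aQ).
Qed.

Lemma ultra_ae1 (P Q : XU -> Prop) : (forall q, P q -> Q q) ->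
  {ae muU, forall q, P q} -> {ae muU, forall q, Q q}.
Proof. by move=> PQ aP; apply: (ultra_ae2 _ aP aP) => q Pq _; exact: PQ. Qed.

Lemma ultra_act_internal (a : pmp_action G mu) g (A : nat -> set X) :
  ultra_act a g @^-1` internal U A = internal U (fun i => a g @^-1` A i).
Proof.
apply/seteqP; split=> q; have [x ->] := ultra_classW q => /=.
  by rewrite ultra_actE => /internalE/= h; apply/internalE.
by move=> /internalE/= h; rewrite ultra_actE; apply/internalE.
Qed.

(** A countable cover by internal sets is moved to one of the same total size. *)
Lemma outer_ultra_act (a : pmp_action G mu) g (E : set XU) :
  (mu_ext content (ultra_act a g @^-1` E) <= mu_ext content E)%E.
Proof.
apply: le_ereal_inf_tmp => _ [F [mF EF] <-]; apply: ereal_inf_lbound.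
pose P k A := (forall i : nat, measurable (A i)) /\ F k = internal U A.
have [A AP] : {A : nat -> nat -> set X & forall k, P k (A k)}.
  by apply: (@choice _ _ P) => k; have [B BP] := mF k; exists B.
have mgA k i : measurable (a g @^-1` A k i).
  exact: measurable_preimage (act_measurable a g) ((AP k).1 i).
exists (fun k => internal U (fun i => a g @^-1` A k i)).
  split=> [k|q /EF[k _ Fkq]]; first by exists (fun i => a g @^-1` A k i).
  by exists k => //; rewrite -ultra_act_internal -(AP k).2.
apply: eq_eseriesr => k _; rewrite (AP k).2 !internal_contentE//; last exact: (AP k).1.
have -> : (fun i => mu (a g @^-1` A k i)) = (fun i => mu (A k i)).
  by apply/funext => i; rewrite act_preserving//; exact: (AP k).1.
by [].
Qed.

Lemma outer_measure_cover (E : set XU) (e : \bar R) : (mu_ext content E < e)%E ->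
  exists2 F : nat -> set (ultrapower X U), (forall k, internal_measurable (F k)) &
    E `<=` \bigcup_k F k /\ (muU (\bigcup_k F k) < e)%E.
Proof.
move=> /ereal_inf_lt[_ [F [mF EF] <-] Fe]; exists F => //; split=> //.
apply: le_lt_trans Fe.
have mFU k : measurable (F k : set XU).
  by have [A [mA ->]] := mF k; exact: internal_ultra_measurable.
apply: (@le_trans _ _ (\sum_(k <oo) muU (F k))%E).
  apply: measure_sigma_subadditive => //.
  exact: bigcupT_measurable.
apply: lee_nneseries => // k _.
by have [A [mA ->]] := mF k; rewrite ultra_measure_internal.
Qed.

(** Null sets are moved to sets of outer measure zero, and these are measurable
    for the completed measure. *)
Lemma ae_ultra_act (a : pmp_action G mu) g (P : XU -> Prop) :
  {ae muU, forall q, P q} -> {ae muU, forall q, P (ultra_act a g q)}.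
Proof.
move=> [N [mN N0 PN]].
have E0 : mu_ext content (ultra_act a g @^-1` N) = 0%E.
  apply/eqP; rewrite eq_le; apply/andP; split; last exact: mu_ext_ge0.
  by rewrite -[leRHS]N0; exact: outer_ultra_act.
exists (ultra_act a g @^-1` N); split=> //; last by move=> q /= nP; exact: PN.
apply: le_caratheodory_measurable => Y.
have Y0 : mu_ext content (Y `&` ultra_act a g @^-1` N) = 0%E.
  apply/eqP; rewrite eq_le; apply/andP; split; last exact: mu_ext_ge0.
  rewrite -[leRHS]E0; apply: le_mu_ext.
  exact: subIsetr.
apply: (@le_trans _ _ (0 + mu_ext content (Y `&` ~` (ultra_act a g @^-1` N)))%E).
  by rewrite -Y0.
by rewrite add0e; apply: le_mu_ext; exact: subIsetl.
Qed.

(** Finitely many sets of an efficient cover already exhaust a measurable set up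
    to a small error, and a finite union of internal sets is internal. *)
Lemma internal_approximation (E : set XU) (e : R) : measurable E -> 0 < e ->
  exists2 A : nat -> set X, (forall i, measurable (A i)) &
    (muU ((E `\` internal U A) `|` (internal U A `\` E)) < e%:E)%E.
Proof.
move=> mE e0; have e2 : 0 < e / 2 by rewrite divr_gt0.
have [F mF [EF Fe]] : exists2 F : nat -> set (ultrapower X U),
    (forall k, internal_measurable (F k)) &
    E `<=` \bigcup_k F k /\ (muU (\bigcup_k F k) < muU E + (e / 2)%:E)%E.
  apply: outer_measure_cover; rewrite lteDl ?lte_fin//; exact: ultra_measure_fin.
have mFU k : measurable (F k : set XU).
  by have [A [mA ->]] := mF k; exact: internal_ultra_measurable.
pose W : set XU := \bigcup_k F k.
pose V n : set XU := \big[setU/set0]_(k < n) F k.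
have mW : measurable W by exact: bigcupT_measurable.
have mV n : measurable (V n) by exact: bigsetU_measurable.
have VW n : V n `<=` W by move=> q; exact: bigsetU_bigcup.
have WE : (muU (W `\` E) < (e / 2)%:E)%E.
  rewrite measureD//; last by rewrite ltey_eq ultra_measure_fin.
  by rewrite setIidr// lteBlDl ?ultra_measure_fin.
have [n Vn] : exists n, (muU (W `\` V n) < (e / 2)%:E)%E.
  have cvgV : muU (V n) @[n --> \oo] --> muU W.
    rewrite (_ : W = \bigcup_n V n); last first.
      apply/seteqP; split=> q [k _ Fk].
        by exists k.+1 => //; rewrite /V big_ord_recr/=; right.
      exact: VW Fk.
    apply: nondecreasing_cvg_mu => //; first exact: bigcupT_measurable.
    by move=> i j ij; apply/subsetPset; exact: subset_bigsetU.
  have : \forall n \near \oo, (muU W - (e / 2)%:E < muU (V n))%E.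
    apply: (cvgV (fun y => (muU W - (e / 2)%:E < y)%E)).
    apply: open_nbhs_nbhs; split; first exact: open_ereal_gt_ereal.
    by rewrite lteBlDr// lteDl ?lte_fin// ultra_measure_fin.
  case=> n _ /(_ n (leqnn n)) h; exists n.
  rewrite measureD//; last by rewrite ltey_eq ultra_measure_fin.
  rewrite setIidr// lteBlDr ?ultra_measure_fin//.
  by rewrite addeC -lteBlDr.
have [A [mA VA]] : internal_measurable (V n).
  rewrite /V; elim/big_ind: _ => [|_ _ [C [mC ->]] [D [mD ->]]|k _]; last exact: mF.
    by exists (fun=> set0); rewrite internal0.
  by exists (fun i => C i `|` D i); split=> [i|]; [exact: measurableU|rewrite internalU].
exists A => //; rewrite -VA (splitr e) EFinD.
apply: le_lt_trans (lteD Vn WE).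
apply: (@le_trans _ _ (muU ((W `\` V n) `|` (W `\` E)))).
  apply: le_measure; rewrite ?inE.
  - by apply: measurableU; exact: measurableD.
  - by apply: measurableU; exact: measurableD.
  - move=> q [[Eq nV]|[Vq nE]]; [left|right]; split=> //; [exact: EF|exact: VW Vq].
by apply: measureU2; exact: measurableD.
Qed.

End ultrapower_facts.

(** * Statistics of a factor of the ultrapower *)

Section ultra_labels.
Context (R : realType) (G : groupType) (d : measure_display).
Context (X : measurableType d) (mu : probability X R).
Context (U : nonprincipal_ultrafilter).
Local Notation XU := (ultra_measurableType mu U).
Local Notation muU := (ultra_measure mu U).

(** The fibres are approximated by internal sets, and at each index a point gets
    the first label whose approximating set contains it: off the union of the
    errors there is exactly one such label. *)
Lemma internal_label (k : nat) (L : XU -> 'I_k) (e : R) : 0 < e ->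
  (forall j, measurable (L @^-1` [set j])) ->
  exists2 l : nat -> X -> 'I_k, (forall n, label_measurable (l n)) &
    exists2 E : set XU, measurable E & (muU E < e%:E)%E /\
      forall q, ~ E q -> internal U (fun n => l n @^-1` [set L q]) q.
Proof.
move=> e0 mL; pose dl := e / (k%:R + 1).
have k1 : 0 < k%:R + 1 :> R by rewrite ltr_wpDl.
have dl0 : 0 < dl by rewrite divr_gt0.
pose P (j : 'I_k) (A : nat -> set X) := (forall i, measurable (A i)) /\
    (muU ((L @^-1` [set j] `\` internal U A) `|`
          (internal U A `\` L @^-1` [set j])) < dl%:E)%E.
have [A AP] : {A : 'I_k -> nat -> set X & forall j, P j (A j)}.
  apply: choice => j; have [A mA Ae] := internal_approximation (mL j) dl0.
  by exists A.
pose E j : set XU := (L @^-1` [set j] `\` internal U (A j)) `|`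
          (internal U (A j) `\` L @^-1` [set j]).
have mE j : measurable (E j).
  have mI : measurable (internal U (A j) : set XU).
    exact: internal_ultra_measurable (AP j).1.
  by apply: measurableU; exact: measurableD.
pose bits n x : {ffun 'I_k -> bool} := [ffun j => `[< A j n x >]].
pose F (t : {ffun 'I_k -> bool}) : 'I_k :=
  if [pick j | t j] is Some j then j else L point.
have mbits n : forall t, measurable (bits n @^-1` [set t]).
  apply: finfun_measurable => j; rewrite (set_asbool (A j n)); exact: (AP j).1.
exists (fun n => F \o bits n).
  by move=> n j; exact: (finite_preimage_measurable (F @^-1` [set j]) (mbits n)).
exists (\big[setU/set0]_(j < k) E j); first exact: bigsetU_measurable.
split.
  apply: (@le_lt_trans _ _ (\sum_(j < k) muU (E j))%E).
    exact: measure_bigsetU_le.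
  apply: (@le_lt_trans _ _ (\sum_(j < k) dl%:E)%E).
    by apply: lee_sum => j _; exact: ltW (AP j).2.
  rewrite sumEFin lte_fin sumr_const card_ord -mulr_natl /dl mulrA ltr_pdivrMr//.
  by rewrite mulrC ltr_pM2l// ltrDl.
move=> q; have [x ->] := ultra_classW q; set q0 := ultra_class U x => nE.
have nEj j : ~ E j q0.
  by move=> Ej; apply: nE; rewrite (bigD1 j)//=; left.
apply/internalE => /=.
have h (j : 'I_k) : \forall n \near uf_sets U, `[< A j n (x n) >] = (j == L q0).
  have nj := nEj j.
  have [jL|jL] := eqVneq j (L q0).
    have /internalE Ax : internal U (A j) q0.
      by apply: contrapT => nA; apply: nj; left; split=> //; rewrite /= jL.
    by apply: ufS Ax => n /= ?; apply/asboolP.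
  have /uf_setC : ~ uf_sets U [set n | A j n (x n)].
    move=> Ax; apply: nj; right; split; first exact/internalE.
    by move=> /= Lj; rewrite Lj eqxx in jL.
  by apply: ufS => n /= nA; apply/asboolP.
apply: ufS (filter_forall _ h) => n /= {}h.
rewrite /F; case: pickP => [j|/(_ (L q0))]; rewrite ffunE h; first by move/eqP.
by rewrite eqxx.
Qed.

End ultra_labels.

Section factor_statistics.
Context (R : realType) (G : groupType) (S : seq G) (d : measure_display).
Context (X : measurableType d) (mu : probability X R).
Context (U : nonprincipal_ultrafilter).
Local Notation XU := (ultra_measurableType mu U).
Local Notation muU := (ultra_measure mu U).
Hypothesis HX : standard_borel R X.

(** A coincidence of two translates of the class [q] means a coincidence for
    almost all indices, and preservation of stabilizers turns it into a
    coincidence of translates of [f q]; a pattern is a finite conjunction of such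
    conditions and of equalities of labels. *)
Lemma factor_pattern (a b : pmp_action G mu) (f : XU -> X) r k (l : X -> 'I_k)
    (l' : nat -> X -> 'I_k) (q : XU) :
  (forall g, f (ultra_act a g q) = b g (f q)) ->
  (forall g, ultra_act a g q = q <-> b g (f q) = f q) ->
  (forall g : ballT S r, internal U
    (fun n => l' n @^-1` [set l (f (ultra_act a (val g) q))]) (ultra_act a (val g) q)) ->
  internal U (fun n => pattern S a (l' n) r @^-1` [set pattern S b l r (f q)]) q.
Proof.
have [x ->] := ultra_classW q => fb fs fl; apply/internalE => /=.
set q0 := ultra_class U x in fb fs fl *; set w := pattern S b l r (f q0).
have ht (p : ballT S r * ballT S r) : \forall n \near uf_sets U,
    (a (val p.1) (x n) == a (val p.2) (x n)) = (p \in val (tag w)).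
  case: p => g h; rewrite /w pattern_tag.
  have E : uf_sets U [set n | a (val g) (x n) = a (val h) (x n)] <->
      b (val g) (f q0) = b (val h) (f q0).
    have := fs ((val h)^-1 * val g)%g; rewrite /q0 ultra_actE ultra_classP => fsE.
    split=> [gh|gh].
      have : b ((val h)^-1 * val g)%g (f q0) = f q0.
        apply/fsE; apply: ufS gh => n /= gh.
        by rewrite actM gh -actM mulVg act1.
      by move=> /(congr1 (b (val h))); rewrite -actM mulgA mulgV mul1g.
    have /fsE : b ((val h)^-1 * val g)%g (f q0) = f q0.
      by rewrite actM gh -actM mulVg act1.
    by apply: ufS => n /= /(congr1 (a (val h))); rewrite -actM mulgA mulgV mul1g.
  case: eqP => gh.
    by apply: ufS (E.2 gh) => n /= ->; rewrite eqxx.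
  have /uf_setC : ~ uf_sets U [set n | a (val g) (x n) = a (val h) (x n)].
    by move=> /E.
  by apply: ufS => n /= /eqP/negbTE.
have hl (g : ballT S r) : \forall n \near uf_sets U,
    l' n (a (val g) (x n)) = tagged w (qproj (tag w) g).
  have := fl g; rewrite fb pattern_label ultra_actE => /internalE /=.
  by apply: ufS.
apply: ufS (ufI (filter_forall _ ht) (filter_forall _ hl)) => n /= [{}ht {}hl].
apply/patternP; split=> //; apply/val_inj/setP => p.
by rewrite inE ht.
Qed.

(** The pulled back labelling has exactly the statistics of [b].  Making it
    internal costs a set of measure [dl], and at most [dl] for each translate by
    an element of the ball; then one index realizes the limit statistics. *)
Lemma stab_preserving_local_global (a b : pmp_action G mu) (f : XU -> X) :
  measurable_fun setT f ->
  (forall A : set X, measurable A -> muU (f @^-1` A) = mu A) ->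
  {ae muU, forall q, forall g : G, f (ultra_act a g q) = b g (f q)} ->
  {ae muU, forall q, forall g : G, ultra_act a g q = q <-> b g (f q) = f q} ->
  local_global_contains S a b.
Proof.
move=> mf fmu fb fs; apply: local_global_intro => r k l e ml e0.
pose B := ballT S r; pose W : finType := labelled_qball S r k.
have B1 : 0 < #|B|%:R + 1 :> R by rewrite ltr_wpDl.
have W1 : 0 < #|W|%:R + 1 :> R by rewrite ltr_wpDl.
pose dl := e / ((#|W|%:R + 1) * (#|B|%:R + 1)).
have dl0 : 0 < dl by rewrite divr_gt0// mulr_gt0.
have mL j : measurable ((l \o f) @^-1` [set j]).
  by rewrite comp_preimage; exact: measurable_preimage mf (ml j).
have [l' ml' [E mE [Ee El]]] := internal_label dl0 mL.
have /choice[Z ZP] : forall g : B, exists Z : set XU, [/\ measurable Z,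
    ultra_act a (val g) @^-1` E `<=` Z & (muU Z < dl%:E)%E].
  move=> g; have [|F mF [EF Fe]] := @outer_measure_cover _ _ _ mu U
      (ultra_act a (val g) @^-1` E) dl%:E.
    exact: le_lt_trans (outer_ultra_act a (val g) E) Ee.
  exists (\bigcup_k F k); split=> //; apply: bigcupT_measurable => i.
  by have [A [mA ->]] := mF i; exact: internal_ultra_measurable.
have [N [mN N0 NP]] : {ae muU, forall q, (forall g, f (ultra_act a g q) = b g (f q)) /\
    (forall g, ultra_act a g q = q <-> b g (f q) = f q)}.
  by apply: ultra_ae2 fb fs => q; split.
pose bad : set XU := N `|` \big[setU/set0]_(g : B) Z g.
have mZ : measurable (\big[setU/set0]_(g : B) Z g).
  by apply: bigsetU_measurable => g _; have [] := ZP g.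
have mbad : measurable bad by exact: measurableU.
have bade : fine (muU bad) <= #|B|%:R * dl.
  rewrite -lee_fin fineK ?ultra_measure_fin//.
  have badU : (muU bad <= muU N + muU (\big[setU/set0]_(g : B) Z g))%E.
    exact: measureU2.
  rewrite N0 add0e in badU; apply: (le_trans badU).
  apply: le_trans (measure_bigsetU_le _ _ (fun g => let: And3 m _ _ := ZP g in m)) _.
  apply: (@le_trans _ _ (\sum_(g : B) dl%:E)%E).
    by apply: lee_sum => g _; have [_ _ /ltW] := ZP g.
  by rewrite sumEFin lee_fin sumr_const mulr_natl.
pose I w : set XU := internal U (fun n => pattern S a (l' n) r @^-1` [set w]).
have mpat n w : measurable (pattern S a (l' n) r @^-1` [set w]).
  exact: pattern_measurable.
have mI w : measurable (I w) by exact: internal_ultra_measurable.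
have good q : ~ bad q -> I (pattern S b l r (f q)) q.
  move=> nbad.
  have [fbq fsq] : (forall g, f (ultra_act a g q) = b g (f q)) /\
      (forall g, ultra_act a g q = q <-> b g (f q) = f q).
    by apply: contrapT => nP; apply: nbad; left; exact: NP.
  apply: factor_pattern => // g; apply: El => Eg; apply: nbad; right.
  by rewrite (bigD1 g)//=; left; have [_ + _] := ZP g; apply.
have I_inj w w' q : I w q -> I w' q -> w = w'.
  have [x ->] := ultra_classW q => /internalE Iw /internalE Iw'.
  by have /filter_ex[n [/= -> ->]] := ufI Iw Iw'.
have mJ w : measurable (f @^-1` (pattern S b l r @^-1` [set w])).
  exact: measurable_preimage mf (pattern_measurable HX b ml w).
have upstairs w : `|local_stat b l w - fine (muU (I w))| <= #|B|%:R * dl.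
  have le_bad (C D : set XU) : measurable C -> measurable D -> C `<=` D `|` bad ->
      fine (muU C) - fine (muU D) <= #|B|%:R * dl.
    move=> mC mD CD; rewrite lerBlDl.
    apply: le_trans (lerD (lexx _) bade).
    rewrite -lee_fin EFinD !fineK ?ultra_measure_fin//.
    apply: le_trans (measureU2 _ mD mbad).
    by apply: le_measure; rewrite ?inE//; exact: measurableU.
  rewrite local_statE -fmu; last exact: pattern_measurable.
  rewrite ler_norml; apply/andP; split.
    rewrite lerNl opprB; apply: le_bad => // q Iq.
    have [?|/good Iq'] := pselect (bad q); [by right|left].
    exact: I_inj Iq' Iq.
  apply: le_bad => // q fq.
  have [?|nq] := pselect (bad q); [by right|left].
  by rewrite -(fq : pattern S b l r (f q) = w); exact: good.
have [n near_n] : exists n, forall w,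
    `|fine (muU (I w)) - local_stat a (l' n) w| < dl.
  have h w : \forall n \near uf_sets U, `|fine (muU (I w)) - local_stat a (l' n) w| < dl.
    have /cvgrPdist_lt/(_ _ dl0) := @ultra_pr_cvg _ _ _ mu U _ (fun n => mpat n w).
    by apply: filterS => n; rewrite local_statE.
  by case: (filter_ex (filter_forall _ h)) => n hn; exists n.
exists (l' n) => //; apply: tv_le_sum => //.
apply: (@le_lt_trans _ _ (\sum_(w : W) (#|B|%:R + 1) * dl)).
  apply: ler_sum => w _; rewrite mulrDl mul1r.
  apply: le_trans (ler_distD (fine (muU (I w))) _ _) _.
  by rewrite lerD// ltW.
have -> : \sum_(w : W) (#|B|%:R + 1) * dl = #|W|%:R * ((#|B|%:R + 1) * dl).
  by rewrite sumr_const [RHS]mulr_natl.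
rewrite (_ : _ * _ = e * (#|W|%:R / (#|W|%:R + 1))); last first.
  by rewrite /dl; field; rewrite !lt0r_neq0.
by rewrite gtr_pMr// ltr_pdivrMr// mul1r ltrDl.
Qed.

End factor_statistics.

(** * Approximating maps and their ultralimit *)

Section approximating_maps.
Context (R : realType) (G : groupType) (S : seq G) (d : measure_display).
Context (X : measurableType d) (mu : probability X R).

Definition bits (A : nat -> set X) (n : nat) (x : X) : {ffun 'I_n -> bool} :=
  [ffun i : 'I_n => `[< A i x >]].

Lemma bits_measurable (A : nat -> set X) n : (forall i, measurable (A i)) ->
  label_measurable (fun x => enum_rank (bits A n x)).
Proof.
move=> mA i; rewrite (_ : _ @^-1` _ = bits A n @^-1` [set enum_val i]).
  by apply: finfun_measurable => j; rewrite set_asbool.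
by apply/seteqP; split=> [x <-|x /= ->]; rewrite /= ?enum_rankK ?enum_valK.
Qed.

(** Up to small errors, [s n] plays in [a] the role of the identity map in [b],
    as far as the sets [A i] and the orbit relation can tell.  In both actions the
    map factors through the same function [sg n], from itineraries to points: on
    the side of [b] a point is replaced by another one with the same bits, which
    is invisible to the first [n] sets, and on the side of [a] itineraries come
    from a labelling with close statistics at radius [n]. *)
Lemma approximating_maps (a b : pmp_action G mu) (A : nat -> set X) :
  standard_borel R X -> local_global_contains S a b ->
  (forall i, measurable (A i)) ->
  exists2 s : nat -> X -> X, (forall n C, measurable (s n @^-1` C)) &
    forall E : pmp_action G mu -> (X -> X) -> X -> bool, local_map S E ->
    (exists N, forall t t' : X -> X,
      (forall x i, (i < N)%N -> A i (t x) <-> A i (t' x)) ->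
      forall x, E b t x = E b t' x) ->
    fine (mu [set x | E a (s n) x]) @[n --> \oo] --> fine (mu [set x | E b id x]).
Proof.
move=> HX ab mA.
pose l n x := enum_rank (bits A n x).
have ml n : label_measurable (l n) := bits_measurable mA.
pose T n : finType := {ffun 'I_n -> bool}.
have approx n : exists l' : X -> 'I_#|T n|, label_measurable l' /\
    total_variation (@local_stat _ _ S _ _ _ b n _ (l n)) (local_stat a l') < n.+1%:R^-1.
  have n1 : 0 < n.+1%:R^-1 :> R by rewrite invr_gt0.
  by have [l' ml' tvl'] := local_global_approx ab n (ml n) n1; exists l'.
pose l' n := projT1 (cid (approx n)).
have l'P n : label_measurable (l' n) /\ total_variation
    (@local_stat _ _ S _ _ _ b n _ (l n)) (local_stat a (l' n)) < n.+1%:R^-1.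
  exact: projT2 (cid (approx n)).
pose sg n (c : 'I_#|T n|) := get [set x | l n x = c].
have sgE n x i : (i < n)%N -> A i (sg n (l n x)) <-> A i x.
  move=> ni; have : l n (sg n (l n x)) = l n x.
    by apply: (@getPex X [set y | l n y = l n x]); exists x.
  move=> /enum_rank_inj/ffunP/(_ (Ordinal ni)); rewrite !ffunE/= => h.
  by split=> /asboolP; [rewrite h|rewrite -h] => /asboolP.
exists (fun n => sg n \o l' n).
  move=> n C; exact: (finite_preimage_measurable (sg n @^-1` C) (l'P n).1).
move=> E lE [N EN]; apply/cvgrPdist_lt => e e0.
have [r _ Er] := local_map_event HX a b lE.
near=> n.
have rn : (r <= n)%N by near: n; exact: nbhs_infty_ge.
have nN : (N <= n)%N by near: n; exact: nbhs_infty_ge.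
have ne : n.+1%:R^-1 < e by near: n; exact: near_infty_natSinv_lt (PosNum e0).
have -> : [set x | E b id x] = [set x | E b (sg n \o l n) x].
  have Eid x : E b (sg n \o l n) x = E b id x.
    by apply: EN => y i iN; exact: sgE (leq_trans iN nN).
  by apply/seteqP; split=> x /=; rewrite Eid.
apply: lt_trans ne; have [ml' tvl'] := l'P n.
exact: (Er n rn _ (sg n) _ _ _ (ml n) ml' tvl').
Unshelve. all: by end_near. Qed.

End approximating_maps.

Section ultralimit_tools.
Context (R : realType) (d : measure_display) (X : measurableType d).
Context (mu : probability X R) (U : nonprincipal_ultrafilter).
Local Notation XU := (ultra_measurableType mu U).
Local Notation muU := (ultra_measure mu U).

Lemma uf_eventually (A : set nat) : (\forall n \near \oo, A n) -> uf_sets U A.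
Proof. by case=> N _ NA; apply: ufS (uf_cofinite U N) => n; exact: NA. Qed.

Lemma ultra_measure_lim (E : nat -> set X) (D : set X) :
  (forall n, measurable (E n)) -> measurable D ->
  fine (mu (E n)) @[n --> \oo] --> fine (mu D) -> muU (internal U E) = mu D.
Proof.
move=> mE mD ED.
have UD : fine (mu (E n)) @[n --> uf_sets U] --> fine (mu D).
  by apply: cvg_trans ED => V /uf_eventually.
have := @cvg_unique _ (@Rhausdorff R) _ _ _ _ UD (@ultra_pr_cvg _ _ _ mu U _ mE).
move=> h; rewrite (prE mu mD) h fineK//.
exact/ultra_measure_fin/internal_ultra_measurable.
Qed.

Lemma ultra_ae_forall (P : nat -> XU -> Prop) :
  (forall n, {ae muU, forall q, P n q}) -> {ae muU, forall q, forall n, P n q}.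
Proof. by move=> aP; apply/ae_foralln. Qed.

Lemma ultra_ae_iff (C D : set XU) : measurable C -> measurable D ->
  muU (C `&` D) = muU C -> muU C = muU D -> {ae muU, forall q, C q <-> D q}.
Proof.
move=> mC mD CDC CD.
have mCD : measurable (C `&` D) by exact: measurableI.
have fin E : measurable E -> (muU E < +oo)%E.
  by move=> mE; rewrite ltey_eq ultra_measure_fin.
exists ((C `\` D) `|` (D `\` C)); split.
- by apply: measurableU; exact: measurableD.
- apply/eqP; rewrite -measure_le0.
  apply: (@le_trans _ _ (muU (C `\` D) + muU (D `\` C))%E).
    by apply: measureU2; exact: measurableD.
  have D1 : muU (C `\` D) = (muU C - muU (C `&` D))%E.
    by apply: measureD => //; exact: fin.
  have D2 : muU (D `\` C) = (muU D - muU (D `&` C))%E.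
    by apply: measureD => //; exact: fin.
  by rewrite D1 D2 (setIC D) CDC CD subee ?adde0// ultra_measure_fin.
- move=> q /= nCD; have [Cq|nCq] := pselect (C q); have [Dq|nDq] := pselect (D q).
  + by exfalso; apply: nCD.
  + by left.
  + by right.
  + by exfalso; apply: nCD; split.
Qed.

End ultralimit_tools.

Section lifting.
Context (R : realType) (d : measure_display) (X : measurableType d).
Context (mu : probability X R) (U : nonprincipal_ultrafilter).
Local Notation XU := (ultra_measurableType mu U).
Local Notation muU := (ultra_measure mu U).
Variables (s : nat -> X -> X).
Hypothesis ms : forall n C, measurable (s n @^-1` C).

(** The preimage of [C] under the formal limit of the maps [s n]; it commutes
    exactly with finite Boolean operations, on arbitrary sets. *)
Definition lift (C : set X) : set XU := internal U (fun n => s n @^-1` C).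

Lemma lift_measurable C : measurable (lift C).
Proof. by apply: internal_ultra_measurable => n; exact: ms. Qed.

Lemma liftE C (q : XU) : lift C q <->
  uf_sets U [set n | C (s n (repr (q : ultrapower X U) n))].
Proof.
have {1}-> : q = ultra_class U (repr (q : ultrapower X U)).
  by rewrite /ultra_class reprK.
exact: internalE.
Qed.

Lemma liftI C D : lift (C `&` D) = lift C `&` lift D.
Proof. by rewrite /lift -internalI. Qed.

Lemma liftT : lift setT = setT.
Proof. exact: internalT. Qed.

Lemma lift_sub C D : C `<=` D -> lift C `<=` lift D.
Proof. by move=> CD q /liftE Cq; apply/liftE; apply: ufS Cq => n; exact: CD. Qed.

(** An ultrafilter that contains a finite union contains one of its members. *)
Lemma lift_exists (A : nat -> set X) (I : set nat) N q :
  lift [set x | exists i, [/\ (i < N)%N, I i & A i x]] q ->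
  exists2 i, I i & lift (A i) q.
Proof.
move=> /liftE h; apply: contrapT => none.
have nA (i : 'I_N) : \forall n \near uf_sets U,
    ~ (I i /\ A i (s n (repr (q : ultrapower X U) n))).
  have [Ii|nI] := pselect (I i); last by apply: ufS (ufT U) => n _ [].
  have /uf_setC : ~ uf_sets U [set n | A i (s n (repr (q : ultrapower X U) n))].
    by move=> /liftE Ai; apply: none; exists (i : nat).
  by apply: ufS => n nA [].
case: (filter_ex (ufI h (filter_forall _ nA))) => n [/= [i [iN Ii Ai]]].
by move=> /(_ (Ordinal iN)); apply.
Qed.

Variable A : nat -> set X.
Hypothesis mA : forall i, measurable (A i).
Hypothesis law : forall (D : set X) N, measurable D ->
  (forall x y, (forall i, (i < N)%N -> A i x <-> A i y) -> D x -> D y) ->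
  muU (lift D) = mu D.

Lemma law_A j : muU (lift (A j)) = mu (A j).
Proof. by apply: (law (N := j.+1)) => // x y xy /xy; apply. Qed.

(** Both sides are limits along finite unions, which are determined by finitely
    many of the sets [A i]. *)
Lemma law_bigcup j (I : set nat) :
  muU (lift (A j) `&` \bigcup_(i in I) lift (A i)) =
  mu (A j `&` \bigcup_(i in I) A i).
Proof.
pose V n := [set x | exists i, [/\ (i < n)%N, I i & A i x]].
have mV n : measurable (V n).
  rewrite (_ : V n = \bigcup_(i in [set i | (i < n)%N /\ I i]) A i).
    by apply: bigcup_measurable.
  by apply/seteqP; split=> [x [i [? ? ?]]|x [i [? ?] ?]]; exists i.
have mC n : measurable (A j `&` V n) by exact: measurableI.
have E1 : A j `&` \bigcup_(i in I) A i = \bigcup_n (A j `&` V n).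
  apply/seteqP; split=> [x [Aj [i Ii Ai]]|x [n _ [Aj [i [_ Ii Ai]]]]].
    by exists i.+1 => //; split=> //; exists i.
  by split=> //; exists i.
have E2 : lift (A j) `&` \bigcup_(i in I) lift (A i) = \bigcup_n lift (A j `&` V n).
  apply/seteqP; split=> [q [Aj [i Ii Ai]]|q [n _]].
    exists i.+1 => //; rewrite liftI; split=> //.
    by apply: lift_sub Ai => x Ai; exists i.
  by rewrite liftI => -[Aj /lift_exists[i Ii Ai]]; split=> //; exists i.
have nd n m : (n <= m)%N -> A j `&` V n `<=` A j `&` V m.
  move=> nm x [Aj [i [iN Ii Ai]]]; split=> //; exists i; split=> //.
  exact: leq_trans nm.
have cE : mu (A j `&` V n) @[n --> \oo] --> mu (\bigcup_n (A j `&` V n)).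
  apply: nondecreasing_cvg_mu => //; first exact: bigcupT_measurable.
  by move=> n m nm; apply/subsetPset; exact: nd.
have cU : muU (lift (A j `&` V n)) @[n --> \oo] --> muU (\bigcup_n lift (A j `&` V n)).
  apply: nondecreasing_cvg_mu => [n||n m nm]; first exact: lift_measurable.
    by apply: bigcupT_measurable => n; exact: lift_measurable.
  by apply/subsetPset; apply: lift_sub; exact: nd.
rewrite E1 E2; apply: (cvg_unique _ cU) => //.
rewrite (_ : (fun n => _) = (fun n => mu (A j `&` V n)))//.
apply/funext => n; apply: (law (N := maxn j.+1 n)) => //.
move=> x y xy [Aj [i [iN Ii Ai]]]; split.
  by apply/xy => //; rewrite leq_max ltnSn.
exists i; split=> //; apply/xy => //.
by rewrite leq_max iN orbT.
Qed.

End lifting.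

Section limit_map.
Context (R : realType) (d : measure_display) (X : measurableType d).
Context (mu : probability X R) (U : nonprincipal_ultrafilter).
Local Notation XU := (ultra_measurableType mu U).
Local Notation muU := (ultra_measure mu U).

Variables (P : completePseudoMetricType R) (phi : X -> P) (psi : P -> X).
Hypothesis phiK : cancel phi psi.
Hypothesis psiK : cancel psi phi.
Hypothesis mphi : forall V : set P, measurable (phi @^-1` V) <-> <<s open >> V.

(** The Borel structure of [X], seen without the model [P]; it makes the open sets
    a generating class for uniqueness of measures on [X]. *)
Lemma preimage_open_generated :
  measurable = <<s [set phi @^-1` V | V in @open P] >> :> set (set X).
Proof.
apply/seteqP; split=> [C mC|]; last first.
  apply: smallest_sub; first exact: sigma_algebra_measurable.
  by move=> _ [V oV <-]; apply/mphi; exact: sub_sigma_algebra.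
have CE : C = phi @^-1` (psi @^-1` C).
  by apply/seteqP; split=> x /=; rewrite phiK.
have : <<s open >> (psi @^-1` C) by apply/mphi; rewrite -CE.
rewrite {2}CE.
set G := [set phi @^-1` V | V in @open P].
apply: (@smallest_sub _ _ _ [set V | <<s G >> (phi @^-1` V)]) => [|V oV].
  split=> [|V GV|F GF] /=.
  - by rewrite preimage_set0; exact: sigma_algebra0.
  - rewrite setTD preimage_setC -setTD; exact: sigma_algebraCD.
  - by rewrite preimage_bigcup; exact: sigma_algebra_bigcup.
by apply: sub_sigma_algebra; exists V.
Qed.

Variable B : nat -> set P.
Hypothesis Bo : forall i, open (B i).
Hypothesis Bb : forall V x, open V -> V x -> exists2 i, B i x & B i `<=` V.

Variables (s : nat -> X -> X) (A : nat -> set X).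
Hypothesis ms : forall n C, measurable (s n @^-1` C).
Hypothesis mA : forall i, measurable (A i).
Local Notation lift := (@lift R d X mu U s).
Hypothesis law : forall (D : set X) N, measurable D ->
  (forall x y, (forall i, (i < N)%N -> A i x <-> A i y) -> D x -> D y) ->
  muU (lift D) = mu D.
Hypothesis AT : exists j, A j = setT.
Hypothesis AB : forall i, exists j, A j = phi @^-1` B i.

(** The points [s n (x n)] read in the Polish model, as a filter that only
    depends on the class of the sequence [x]. *)
Definition track (q : XU) : set_system P :=
  fmap (fun n => phi (s n (repr (q : ultrapower X U) n))) (uf_sets U).

Instance track_proper q : ProperFilter (track q).
Proof. exact: fmap_proper_filter. Qed.

Lemma trackE q V : track q V <-> lift (phi @^-1` V) q.
Proof. by rewrite liftE. Qed.

Definition ultralimit (q : XU) : X :=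
  if pselect (cvg (track q)) then psi (lim (track q)) else point.

Definition small n : set nat :=
  [set j | exists i p, A j = phi @^-1` B i /\ B i `<=` ball p (n.+1%:R^-1 : R)].

(** Classes whose track is Cauchy, expressed through lifts of basic sets. *)
Definition tame : set XU := \bigcap_n \bigcup_(j in small n) lift (A j).

Lemma tame_cvg q : tame q -> track q --> phi (ultralimit q).
Proof.
move=> tq; have cq : cvg (track q).
  apply: cauchy_cvg; apply: cauchy_exP => e e0.
  have [n ne] : exists n, (n.+1%:R^-1 : R) < e.
    by have [n _ /(_ n (leqnn n))] := near_infty_natSinv_lt (PosNum e0); exists n.
  have [j [i [p [AE Bp]]] Aq] := tq n I.
  exists p; apply/trackE; move: Aq; rewrite AE; apply: lift_sub => x /= Bx.
  exact: le_ball (ltW ne) _ (Bp _ Bx).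
by rewrite /ultralimit; case: pselect => // ?; rewrite psiK.
Qed.

Lemma measurable_bigcup_lift (I : set nat) :
  measurable (\bigcup_(j in I) lift (A j) : set XU).
Proof. by apply: bigcup_measurable => j _; exact: lift_measurable. Qed.

Lemma measurable_tame : measurable tame.
Proof. by apply: bigcapT_measurable => n; exact: measurable_bigcup_lift. Qed.

(** For each [n] the basic sets inside balls of radius [1 / (n + 1)] cover [X], and
    the lifts of a countable union have the measure of the union. *)
Lemma tame_ae : muU (~` tame) = 0%E.
Proof.
rewrite /tame setC_bigcap; apply/eqP; rewrite -measure_le0.
have mn n : measurable (~` (\bigcup_(j in small n) lift (A j)) : set XU).
  by apply: measurableC; exact: measurable_bigcup_lift.
apply: (@le_trans _ _
    (\sum_(n <oo) muU (~` (\bigcup_(j in small n) lift (A j))))%E).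
  by apply: measure_sigma_subadditive => //; exact: bigcupT_measurable.
rewrite eseries0// => n _ _.
have [j0 A0] := AT; have := law_bigcup ms mA law j0 (small n).
rewrite A0 liftT !setTI (_ : \bigcup_(i in small n) A i = setT); last first.
  apply/seteqP; split=> // x _.
  have n1 : 0 < n.+1%:R^-1 :> R by rewrite invr_gt0.
  have [i Bx Bi] := Bb (open_interior (ball (phi x) n.+1%:R^-1))
    (nbhs_singleton (nbhs_interior (nbhsx_ballx (phi x) _ n1))).
  have [j AE] := AB i; exists j; last by rewrite AE.
  by exists i, (phi x); split=> //; apply: subset_trans Bi (@interior_subset _ _).
rewrite probability_setT => m1.
have -> : muU (~` (\bigcup_(j in small n) lift (A j))) =
    (muU setT - muU (\bigcup_(j in small n) lift (A j)))%E.
  rewrite -setTD; have := @measureD _ _ _ muU setT (\bigcup_(j in small n) lift (A j)).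
  rewrite setTI; apply=> //; first exact: measurable_bigcup_lift.
  by rewrite ltey_eq ultra_measure_fin.
by rewrite m1 ultra_measureT subee.
Qed.

Lemma le_on_tame (C D : set XU) : measurable C -> measurable D ->
  (forall q, tame q -> C q -> D q) -> (muU C <= muU D)%E.
Proof.
move=> mC mD CD; have mt : measurable (~` tame).
  by apply: measurableC; exact: measurable_tame.
apply: (@le_trans _ _ (muU (D `|` ~` tame))%E).
  apply: le_measure; rewrite ?inE//; first exact: measurableU.
  move=> q Cq; have [tq|ntq] := pselect (tame q); last by right.
  by left; exact: CD.
apply: (@le_trans _ _ (muU D + muU (~` tame))%E); last by rewrite tame_ae adde0.
exact: measureU2.
Qed.

Definition inside (V : set P) : set nat :=
  [set j | exists i, A j = phi @^-1` B i /\ closure (B i) `<=` V].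

(** The track is eventually in every basic neighbourhood of its limit, and its
    limit lies in the closure of every set in which the track is eventually. *)
Lemma ultralimit_open V q : open V -> tame q ->
  V (phi (ultralimit q)) <-> (\bigcup_(j in inside V) lift (A j)) q.
Proof.
move=> oV /tame_cvg; set y := phi _ => qy; split=> [Vy|[j [i [AE BV]]]].
  have [i By BV] := basis_regular Bb oV Vy.
  have [j AE] := AB i; exists j; first by exists i.
  by rewrite AE; apply/trackE/qy; exact: open_nbhs_nbhs.
rewrite AE => /trackE Bq; apply: BV => W /qy Wq.
by have [z [Bz Wz]] := filter_ex (filterI Bq Wq); exists z.
Qed.

Lemma ultralimit_measurable : measurable_fun setT ultralimit.
Proof.
move=> _ C mC; rewrite setTI; move: C mC; rewrite preimage_open_generated.
apply: (@smallest_sub _ _ _ [set C | measurable (ultralimit @^-1` C)]).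
  split=> [|C mC|F mF] /=.
  - by rewrite preimage_set0.
  - by rewrite setTD preimage_setC; exact: measurableC.
  - by rewrite preimage_bigcup; exact: bigcupT_measurable.
move=> _ [V oV <-] /=.
have -> : ultralimit @^-1` (phi @^-1` V) =
    (tame `&` \bigcup_(j in inside V) lift (A j)) `|`
    (~` tame `&` ultralimit @^-1` (phi @^-1` V)).
  apply/seteqP; split=> q.
    have [tq|ntq] := pselect (tame q); last by right.
    by move=> /(ultralimit_open oV tq); left.
  by case=> -[tq]// /(ultralimit_open oV tq).
apply: measurableU.
  by apply: measurableI; [exact: measurable_tame|exact: measurable_bigcup_lift].
apply: ultra_measure_complete; exists (~` tame); split.
- by apply: measurableC; exact: measurable_tame.
- exact: tame_ae.
- by move=> q [].
Qed.

Lemma measurable_ultralimit_preimage C : measurable C ->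
  measurable (ultralimit @^-1` C).
Proof. exact: measurable_preimage ultralimit_measurable. Qed.

(** Both sides are finite measures in [C]; they agree on open sets, where the
    limit map is described by the lifts of basic sets, and open sets are closed
    under intersection. *)
Lemma ultralimit_law j C : measurable C ->
  muU (lift (A j) `&` ultralimit @^-1` C) = mu (A j `&` C).
Proof.
have mlA : measurable (lift (A j)) by exact: lift_measurable.
have mlC D : measurable D -> measurable (lift (A j) `&` ultralimit @^-1` D).
  by move=> mD; apply: measurableI => //; exact: measurable_ultralimit_preimage.
have jT : muU (lift (A j)) = mu (A j) by exact: law_A.
rewrite preimage_open_generated; move: C; apply: dynkin_induction.
- exact: preimage_open_generated.
- move=> _ _ [V oV <-] [W oW <-]; exists (V `&` W) => //; exact: openI.
- by rewrite preimage_setT !setIT.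
- move=> _ [V oV <-].
  have -> : A j `&` phi @^-1` V = A j `&` \bigcup_(i in inside V) A i.
    congr (_ `&` _); apply/seteqP; split=> [x Vx|x [i [n [-> nV]] Bx]]; last first.
      exact: nV (subset_closure Bx).
    have [i Bx iV] := basis_regular Bb oV Vx.
    by have [n nE] := AB i; exists n; [exists i|rewrite nE].
  rewrite -(law_bigcup ms mA law).
  have mlI : measurable (lift (A j) `&` \bigcup_(i in inside V) lift (A i)).
    by apply: measurableI => //; exact: measurable_bigcup_lift.
  have mV : measurable (phi @^-1` V) by apply/mphi; exact: sub_sigma_algebra.
  apply/eqP; rewrite eq_le; apply/andP; split; apply: le_on_tame => //;
    try exact: mlC; move=> q tq [Aq Vq]; split=> //.
    exact/(ultralimit_open oV tq).
  exact/(ultralimit_open oV tq).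
- move=> C mC IH; rewrite preimage_setC -!setDE.
  have -> : muU (lift (A j) `\` ultralimit @^-1` C) =
      (muU (lift (A j)) - muU (lift (A j) `&` ultralimit @^-1` C))%E.
    apply: measureD => //; first exact: measurable_ultralimit_preimage.
    by rewrite ltey_eq ultra_measure_fin.
  have -> : mu (A j `\` C) = (mu (A j) - mu (A j `&` C))%E.
    by apply: measureD => //; rewrite ltey_eq fin_num_measure.
  by rewrite jT IH.
- move=> F mF tF IH; rewrite preimage_bigcup !setI_bigcupr.
  have tI (T : Type) (D : set T) (H : (set T)^nat) : trivIset setT H ->
      trivIset setT (fun k => D `&` H k).
    move=> /trivIsetP tH; apply/trivIsetP => m n _ _ mn.
    by rewrite setIACA tH// setI0.
  have h1 : (\sum_(0 <= k < n)
      muU (lift (A j) `&` ultralimit @^-1` F k))%E @[n --> \oo] -->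
      muU (\bigcup_k (lift (A j) `&` ultralimit @^-1` F k)).
    apply: measure_semi_sigma_additive => [n||].
    - exact: mlC.
    - by apply: tI; apply/trivIsetP => m n _ _ mn; rewrite -preimage_setI;
        move/trivIsetP : tF => ->//; rewrite preimage_set0.
    - by apply: bigcupT_measurable => n; exact: mlC.
  have h2 : (\sum_(0 <= k < n) mu (A j `&` F k))%E @[n --> \oo] -->
      mu (\bigcup_k (A j `&` F k)).
    apply: measure_semi_sigma_additive => [n||].
    - exact: measurableI.
    - exact: tI.
    - by apply: bigcupT_measurable => n; exact: measurableI.
  apply: (cvg_unique _ h1) => //; move: h2.
  rewrite (_ : (fun n => _) = (fun n =>
    \sum_(0 <= k < n) muU (lift (A j) `&` ultralimit @^-1` F k))%E)//.
  by apply/funext => n; apply: eq_bigr => i _; rewrite IH.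
Qed.

Lemma ultralimit_preserving C : measurable C -> muU (ultralimit @^-1` C) = mu C.
Proof.
move=> mC; have [j AjT] := AT; have := ultralimit_law j mC.
by rewrite AjT liftT !setTI.
Qed.

(** The case [C = A j] of the joint law: the two sets and their intersection have
    the same measure. *)
Lemma ultralimit_ae j : {ae muU, forall q, lift (A j) q <-> A j (ultralimit q)}.
Proof.
have mAj := mA j; apply: (@ultra_ae_iff _ _ _ _ _ (lift (A j)) (ultralimit @^-1` A j)).
- exact: lift_measurable.
- exact: measurable_ultralimit_preimage.
- rewrite ultralimit_law// setIid; apply/esym; exact: law_A.
- rewrite ultralimit_preserving//; exact: law_A.
Qed.

End limit_map.

Lemma nonprincipal_ultrafilter_exists : exists U : nonprincipal_ultrafilter, True.
Proof.
have [U [UU eU]] := @ultraFilterLemma nat \oo _.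
suff Un n : ~ U [set n] by exists (NonprincipalUltrafilter UU Un).
move=> nU; have : U [set m | (n < m)%N] by apply: eU; exists n.+1.
move=> /(filterI nU) /filter_ex[m [/= ->]]; by rewrite ltnn.
Qed.

Lemma measurable_addb d (X : measurableType d) (p q : X -> bool) :
  measurable [set x | p x] -> measurable [set x | q x] ->
  measurable [set x | p x (+) q x].
Proof.
move=> mp mq; rewrite (_ : [set x | p x (+) q x] =
    ([set x | p x] `\` [set x | q x]) `|` ([set x | q x] `\` [set x | p x])).
  by apply: measurableU; exact: measurableD.
apply/seteqP; split=> x /=.
  by case: (p x) (q x) => -[] //= _; [left|right].
by case: (p x) (q x) => -[] // [[]|[]].
Qed.

Section factor_map.
Context (R : realType) (G : groupType) (S : seq G) (d : measure_display).
Context (X : measurableType d) (mu : probability X R).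

(** The family [A] contains the sets [b g @^-1` B i] and the fixed point sets of
    [b].  Being in [B i] after moving by [g], and being fixed by [g], are then
    compared in [a] and in [b] through a local event that is empty in [b], hence
    null in the limit ([null]). *)
Lemma local_global_stab_preserving (a b : pmp_action G mu) :
  marking S -> standard_borel R X -> local_global_contains S a b ->
  stab_preserving_weakly_contains a b.
Proof.
move=> HS HX ab; have [U _] := nonprincipal_ultrafilter_exists.
have [P [phi [hP sP [psi phiK psiK] mphi]]] := HX.
have [B [Bo Bb]] := second_countable_basis (phi point) sP.
have [u uG] := marking_countable HS.
have mB i : measurable (phi @^-1` B i).
  by apply/mphi; exact: sub_sigma_algebra.
pose A n : set X := match unpickle n : option (nat * nat + nat)%type with
  | Some (inl (i, j)) => b (u j) @^-1` (phi @^-1` B i)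
  | Some (inr j) => [set x | b (u j) x = x]
  | None => setT
  end.
have AB i g : exists j, A j = b g @^-1` (phi @^-1` B i).
  have [j <-] := uG g.
  by exists (pickle (inl (i, j) : nat * nat + nat)%type); rewrite /A pickleK.
have AF g : exists j, A j = [set x | b g x = x].
  have [j <-] := uG g.
  by exists (pickle (inr j : nat * nat + nat)%type); rewrite /A pickleK.
have mA n : measurable (A n).
  rewrite /A; case: unpickle => [[[i j]|j]|]; last exact: measurableT.
    exact: measurable_preimage (act_measurable b (u j)) (mB i).
  apply: standard_borel_eq_measurable HX (act_measurable b (u j)) _.
  exact: measurable_id.
have [s ms sE] := approximating_maps HX ab mA.
have sU (E : pmp_action G mu -> (X -> X) -> X -> bool) : local_map S E ->
    (forall c n, measurable [set x | E c (s n) x]) -> measurable [set x | E b id x] ->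
    (exists N, forall t t' : X -> X,
      (forall x i, (i < N)%N -> A i (t x) <-> A i (t' x)) ->
      forall x, E b t x = E b t' x) ->
    ultra_measure mu U (internal U (fun n => [set x | E a (s n) x])) =
    mu [set x | E b id x].
  by move=> lE mE mEb EN; apply: ultra_measure_lim => //; exact: sE.
have null (E : pmp_action G mu -> (X -> X) -> X -> bool) : local_map S E ->
    (forall c n, measurable [set x | E c (s n) x]) -> (forall x, ~~ E b id x) ->
    (exists N, forall t t' : X -> X,
      (forall x i, (i < N)%N -> A i (t x) <-> A i (t' x)) ->
      forall x, E b t x = E b t' x) ->
    {ae ultra_measure mu U, forall q, forall x, q = ultra_class U x ->
      uf_sets U [set n | ~~ E a (s n) (x n)]}.
  move=> lE mE E0 EN; exists (internal U (fun n => [set x | E a (s n) x])); split.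
  - exact: internal_ultra_measurable.
  - have Eb0 : [set x | E b id x] = set0.
      by apply/seteqP; split=> x //= Ex; have := E0 x; rewrite Ex.
    by rewrite sU// Eb0 ?measure0//; exact: measurable0.
  - move=> q /= /existsNP[x /not_implyP[-> nE]]; apply/internalE => /=.
    apply: contrapT => /uf_setC h; apply: nE.
    by apply: ufS h => n /= /negP.
have law D N : measurable D ->
    (forall x y, (forall i, (i < N)%N -> A i x <-> A i y) -> D x -> D y) ->
    ultra_measure mu U (@lift R d X mu U s D) = mu D.
  move=> mD DN.
  pose E (c : pmp_action G mu) (t : X -> X) x := `[< D (t (c 1%g x)) >].
  have ET c t : [set x | E c t x] = t @^-1` D.
    by apply/seteqP; split=> x; rewrite /E/= act1 => /asboolP.
  have := @sU E; rewrite (ET b id) /lift.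
  have -> : (fun n => [set x | E a (s n) x]) = (fun n => s n @^-1` D).
    by apply/funext => n; rewrite ET.
  apply.
  - exact: (local_map_comp (fun y => `[< D y >]) (local_map_label mu HS _ 1%g)).
  - by move=> c n; rewrite ET.
  - by [].
  - exists N => t t' tt' x; apply: asbool_equiv_eq; rewrite act1.
    by split; apply: DN => i iN; [exact: tt'|apply: iff_sym; exact: tt'].
have AT : exists j, A j = setT.
  have [j AE] := AF 1%g; exists j; rewrite AE.
  by apply/seteqP; split=> // x _ /=; rewrite act1.
have AB1 i : exists j, A j = phi @^-1` B i.
  have [j AE] := AB i 1%g; exists j; rewrite AE.
  by apply/seteqP; split=> x /=; rewrite act1.
have mbit (c : pmp_action G mu) k g j : measurable [set x | `[< A j (s k (c g x)) >]].
  rewrite (set_asbool (fun x => A j (s k (c g x)))).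
  exact: (measurable_preimage (act_measurable c g) (ms k (A j))).
pose f := @ultralimit R d X mu U P phi psi s.
have fae j := ultralimit_ae phiK psiK mphi Bo Bb ms mA law AT AB1 j.
have mf := ultralimit_measurable phiK psiK mphi Bo Bb ms mA law AT AB1.
have fmu := ultralimit_preserving phiK psiK mphi Bo Bb ms mA law AT AB1.
exists U, f; split; [exact: mf|exact: fmu|..].
- have equi n i : {ae ultra_measure mu U, forall q,
      B i (phi (f (ultra_act a (u n) q))) <-> B i (phi (b (u n) (f q)))}.
    have [j0 A0] := AB1 i; have [j AE] := AB i (u n).
    pose E (c : pmp_action G mu) (t : X -> X) x :=
      `[< A j0 (t (c (u n) x)) >] (+) `[< A j (t (c 1%g x)) >].
    have aE : {ae ultra_measure mu U, forall q,
        @lift R d X mu U s (A j0) (ultra_act a (u n) q) <-> @lift R d X mu U s (A j) q}.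
      have EN : {ae ultra_measure mu U, forall q, forall x, q = ultra_class U x ->
          uf_sets U [set n | ~~ E a (s n) (x n)]}.
        apply: null.
        - exact: (local_map_comp2 addb
            (local_map_comp (fun y => `[< A j0 y >]) (local_map_label mu HS _ (u n)))
            (local_map_comp (fun y => `[< A j y >]) (local_map_label mu HS _ 1%g))).
        - by move=> c k; apply: measurable_addb; exact: mbit.
        - by move=> x; rewrite /E act1 AE A0 addbb.
        - exists (maxn j j0).+1 => t t' tt' x; rewrite /E; congr addb;
            by apply: asbool_equiv_eq; apply: tt'; rewrite ltnS leq_max leqnn ?orbT.
      apply: ultra_ae1 EN => q Eq.
      have [x qx] := ultra_classW q; have := Eq x qx.
      rewrite qx ultra_actE /lift => Ex; split=> /internalE/= h; apply/internalE => /=;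
        apply: ufS (ufI h Ex) => k [/=]; rewrite /E act1.
        move=> Aj; have -> : `[< A j0 (s k (a (u n) (x k))) >] by apply/asboolP.
        by rewrite addTb negbK => /asboolP.
      move=> Aj; have -> : `[< A j (s k (x k)) >] by apply/asboolP.
      by rewrite addbT negbK => /asboolP.
    have ae0 : {ae ultra_measure mu U, forall q,
        @lift R d X mu U s (A j0) (ultra_act a (u n) q) <->
        A j0 (f (ultra_act a (u n) q))}.
      exact: (ae_ultra_act a (u n) (fae j0)).
    have ae01 : {ae ultra_measure mu U, forall q,
        A j0 (f (ultra_act a (u n) q)) <-> @lift R d X mu U s (A j) q}.
      apply: (ultra_ae2 _ ae0 aE) => q h0 h1.
      by apply: iff_trans h1; apply: iff_sym.
    apply: (ultra_ae2 _ ae01 (fae j)) => q h01 h.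
    by move: h01 h; rewrite A0 AE; exact: iff_trans.
  have all_equi : {ae ultra_measure mu U, forall q, forall n i,
      B i (phi (f (ultra_act a (u n) q))) <-> B i (phi (b (u n) (f q)))}.
    by apply: ultra_ae_forall => n; apply: ultra_ae_forall => i; exact: equi.
  apply: ultra_ae1 all_equi => q h g.
  have [n <-] := uG g; apply: (can_inj phiK).
  exact: basis_separates hP Bb _ _ (h n).
- have stab n : {ae ultra_measure mu U, forall q,
      ultra_act a (u n) q = q <-> b (u n) (f q) = f q}.
    have [j AE] := AF (u n).
    pose E (c : pmp_action G mu) (t : X -> X) x :=
      `[< A j (t (c 1%g x)) >] (+) (c (u n) x == c 1%g x).
    have EN : {ae ultra_measure mu U, forall q, forall x, q = ultra_class U x ->
        uf_sets U [set n | ~~ E a (s n) (x n)]}.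
      apply: null.
      - exact: (local_map_comp2 addb
          (local_map_comp (fun y => `[< A j y >]) (local_map_label mu HS _ 1%g))
          (local_map_eq mu HS _ (u n) 1%g)).
      - move=> c k; apply: measurable_addb; first exact: mbit.
        rewrite (_ : [set x | _] = [set x | c (u n) x = c 1%g x]).
          apply: standard_borel_eq_measurable HX _ _; exact: act_measurable.
        by apply/seteqP; split=> x /eqP.
      - move=> x; rewrite /E act1 AE /=; case: eqP => ux; rewrite ?addbT ?addbF ?negbK.
          exact/asboolP.
        exact/asboolP.
      - exists j.+1 => t t' tt' x; rewrite /E; congr addb.
        by apply: asbool_equiv_eq; exact: tt'.
    apply: ultra_ae2 EN (fae j) => q Eq; rewrite AE => fq.
    apply: iff_trans fq; have [x qx] := ultra_classW q; have := Eq x qx.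
    rewrite qx ultra_actE /lift -AE => Ex; split.
      move=> /ultra_classP h; apply/internalE => /=.
      apply: ufS (ufI h Ex) => k [/= ux]; rewrite /E act1 ux eqxx addbT negbK.
      by move=> /asboolP.
    move=> /internalE h; apply/ultra_classP.
    apply: ufS (ufI h Ex) => k [/= Aj]; rewrite /E act1.
    have -> : `[< A j (s k (x k)) >] by apply/asboolP.
    by rewrite addTb negbK => /eqP.
  have all_stab : {ae ultra_measure mu U, forall q, forall n,
      ultra_act a (u n) q = q <-> b (u n) (f q) = f q}.
    by apply: ultra_ae_forall => n; exact: stab.
  apply: ultra_ae1 all_stab => q h g.
  by have [n <-] := uG g.
Qed.

End factor_map.

Theorem theorem1p2 (R : realType) (G : groupType) (S : seq G)
    (HS : marking S) (d : measure_display) (X : measurableType d)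
    (HX : standard_borel R X) (mu : probability X R) (a b : pmp_action G mu) :
  [<-> local_global_contains S a b;
       forall phi : sigma1_sentence R G,
         (sigma1_value a phi <= sigma1_value b phi)%R;
       stab_preserving_weakly_contains a b].
Proof.
have sigma1_local_global : (forall phi : sigma1_sentence R G,
    sigma1_value a phi <= sigma1_value b phi) -> local_global_contains S a b.
  by move=> ab; apply: inner_approximable_local_global => //;
    exact: sigma1_inner_approximable.
tfae.
- move=> ab; apply: inner_approximable_sigma1 => //.
  exact: local_global_inner_approximable ab.
- by move=> /sigma1_local_global; exact: local_global_stab_preserving.
- move=> [U [f [mf fmu fb fs]]].
  exact: stab_preserving_local_global mf fmu fb fs.
Qed.
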